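(* Let $\mathbb{G}(\Gamma)$ and $\mathbb{G}(\Delta)$ be right-angled Artin groups with finite defining graphs $\Gamma$ and $\Delta$. If $\mathbb{G}(\Gamma)\equiv\mathbb{G}(\Delta)$, then $\operatorname{Core}(\Gamma)\simeq\operatorname{Core}(\Delta)$.
   Context: Graphs are finite and simplicial. $\mathbb{G}(\Gamma)$ is the right-angled Artin group defined by $\Gamma$: generators are the vertices of $\Gamma$, and two generators commute when they are adjacent (equivalently, the graph product over $\Gamma$ with all vertex groups $\mathbb{Z}$). $\equiv$ denotes elementary equivalence in the language of groups. $\operatorname{link}(v)$ is the set of vertices adjacent to $v$; $\operatorname{star}(v)=\operatorname{link}(v)\cup\{v\}$. All vertex groups being $\mathbb{Z}$, a vertex $v$ of a graph $\Gamma$ is called weak if there are vertices $w_1,\dots,w_k$ ($k\ge1$) with $(v,w_i)\notin E(\Gamma)$ and $\bigcap_i\operatorname{star}(w_i)=\operatorname{link}(v)$ ($w_i=v$ is allowed). It is redundant if it is weak and there are vertices $w_1,\dots,w_k$, all different from $v$, with $\bigcap_i\operatorname{star}(w_i)=\operatorname{link}(v)$. $\operatorname{Core}(\Gamma)$ is a maximal induced subgraph of $\Gamma$ without redundant vertices (obtained by removing redundant vertices one at a time until none remain); it is well defined up to isomorphism. *)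

(* Defs.v *)
From HB Require Import structures.
From mathcomp Require Import all_boot.
From mathcomp Require Import boolp.

Set Implicit Arguments.
Unset Strict Implicit.
Unset Printing Implicit Defensive.

Local Open Scope group_scope.
Local Open Scope quotient_scope.

(** * Finite simplicial graphs *)

Record graph := Graph {
  vertex :> finType;
  adj : rel vertex;
  adj_sym : symmetric adj;
  adj_irr : irreflexive adj }.

Section Induced.
Variables (G : graph) (S : {set G}).

Definition induced_adj : rel {x : G | x \in S} :=
  fun x y => adj (val x) (val y).

Lemma induced_adj_sym : symmetric induced_adj.
Proof. by move=> x y; apply: adj_sym. Qed.

Lemma induced_adj_irr : irreflexive induced_adj.
Proof. by move=> x; apply: adj_irr. Qed.

Definition induced : graph := Graph induced_adj_sym induced_adj_irr.
End Induced.

Definition graph_iso (G H : graph) : Prop :=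
  exists2 f : G -> H, bijective f & forall x y, adj (f x) (f y) = adj x y.

Definition link (G : graph) (v : G) : {set G} := [set w | adj v w].
Definition star (G : graph) (v : G) : {set G} := v |: link v.

(** * Weak and redundant vertices, cores *)

(* The family w_1, ..., w_k (k >= 1) is given by its nonempty set W of values;
   W may contain v itself, since adj is irreflexive. *)
Definition weak (G : graph) (v : G) : Prop :=
  exists W : {set G},
    [/\ W != set0,
        forall w, w \in W -> ~~ adj v w
      & \bigcap_(w in W) star w = link v].

Definition redundant (G : graph) (v : G) : Prop :=
  weak v /\
  exists W : {set G},
    [/\ W != set0,
        forall w, w \in W -> w != v
      & \bigcap_(w in W) star w = link v].

(* [removal S]: the induced subgraph on S is obtained from G by successively
   removing vertices, each one redundant in the induced subgraph from which it
   is removed. *)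
Inductive removal (G : graph) : {set G} -> Prop :=
| removal_start : removal [set: G]
| removal_step (S : {set G}) (v : induced S) :
    removal S -> redundant v -> removal (S :\ val v).

Definition is_core (G : graph) (S : {set G}) : Prop :=
  removal S /\ forall v : induced S, ~ redundant v.

Lemma core_exists (G : graph) : exists S : {set G}, is_core S.
Proof.
suff H n (S : {set G}) : #|S| <= n -> removal S -> exists T : {set G}, is_core T.
  exact: (H _ _ (leqnn _) (removal_start G)).
elim: n S => [|n IH] S leS rS.
  exists S; split=> // -[x xS]; exfalso; move: xS.
  by move: leS; rewrite leqn0 => /eqP/cards0_eq ->; rewrite inE.
have [[v rv]|nr] := pselect (exists v : induced S, redundant v); last first.
  by exists S; split=> // v rv; apply: nr; exists v.
apply: (IH _ _ (removal_step rS rv)).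
by move: leS; rewrite (cardsD1 (val v) S) (valP v) add1n ltnS.
Qed.

(** * Right-angled Artin groups *)

Section RAAG.
Variable G : graph.

(* The letter (v, true) stands for v, and (v, false) for its inverse. *)
Definition word := seq (G * bool).

Inductive raag_eqv : word -> word -> Prop :=
| raag_refl u : raag_eqv u u
| raag_sym u v : raag_eqv u v -> raag_eqv v u
| raag_trans u v w : raag_eqv u v -> raag_eqv v w -> raag_eqv u w
| raag_cat u u' v v' :
    raag_eqv u u' -> raag_eqv v v' -> raag_eqv (u ++ v) (u' ++ v')
| raag_cancel x b : raag_eqv [:: (x, b); (x, ~~ b)] [::]
| raag_comm x y : adj x y ->
    raag_eqv [:: (x, true); (y, true)] [:: (y, true); (x, true)].

Definition raag_eqb : rel word := fun u v => `[< raag_eqv u v >].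

Lemma raag_eqb_refl : reflexive raag_eqb.
Proof. by move=> u; apply/asboolP/raag_refl. Qed.

Lemma raag_eqb_sym : symmetric raag_eqb.
Proof. by move=> u v; apply/asboolP/asboolP; apply: raag_sym. Qed.

Lemma raag_eqb_trans : transitive raag_eqb.
Proof. by move=> v u w /asboolP uv /asboolP vw; apply/asboolP/(raag_trans uv). Qed.

Canonical raag_equiv := EquivRel raag_eqb raag_eqb_refl raag_eqb_sym raag_eqb_trans.

Definition raag := {eq_quot raag_equiv}.

HB.instance Definition _ : EqQuotient _ raag_eqb raag := EqQuotient.on raag.
HB.instance Definition _ := Choice.on raag.

Definition winv (u : word) : word := rev [seq (p.1, ~~ p.2) | p <- u].

Lemma raag_piP (u v : word) : reflect (raag_eqv u v) (\pi_raag u == \pi_raag v).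
Proof. by rewrite eqmodE; apply: asboolP. Qed.

Lemma raag_eqv_repr (u : word) : raag_eqv (repr (\pi_raag u)) u.
Proof. by apply/raag_piP; rewrite reprK. Qed.

Lemma winv_cat u v : winv (u ++ v) = winv v ++ winv u.
Proof. by rewrite /winv map_cat rev_cat. Qed.

Lemma winvK : involutive winv.
Proof.
move=> u; rewrite /winv map_rev revK -map_comp map_id_in // => -[x b] _ /=.
by rewrite negbK.
Qed.

Lemma winv_mulV u : raag_eqv (u ++ winv u) [::].
Proof.
elim: u => [|[x b] u IH]; first exact: raag_refl.
rewrite -cat1s winv_cat -catA [u ++ _]catA.
apply: raag_trans (raag_cancel x b).
apply: (@raag_cat [:: (x, b)] [:: (x, b)] _ [:: (x, ~~ b)]); first exact: raag_refl.
by apply: (@raag_cat _ [::]) (raag_refl _).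
Qed.

Lemma winv_Vmul u : raag_eqv (winv u ++ u) [::].
Proof. by rewrite -{2}(winvK u); apply: winv_mulV. Qed.

Lemma winv_eqv u v : raag_eqv u v -> raag_eqv (winv u) (winv v).
Proof.
move=> uv.
apply: (@raag_trans _ (winv u ++ (v ++ winv v))).
  rewrite -{1}[winv u]cats0; apply: raag_cat (raag_refl _) _.
  exact/raag_sym/winv_mulV.
rewrite catA; apply: (@raag_cat _ [::]) (raag_refl _).
apply: raag_trans (winv_Vmul u).
exact: raag_cat (raag_refl _) (raag_sym uv).
Qed.

Definition raag_one : raag := \pi_raag [::].
Definition raag_mul (x y : raag) : raag := \pi_raag (repr x ++ repr y).
Definition raag_inv (x : raag) : raag := \pi_raag (winv (repr x)).

Lemma raag_mulE u v : raag_mul (\pi_raag u) (\pi_raag v) = \pi_raag (u ++ v).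
Proof. by apply/eqP/raag_piP/raag_cat; apply: raag_eqv_repr. Qed.

Lemma raag_invE u : raag_inv (\pi_raag u) = \pi_raag (winv u).
Proof. by apply/eqP/raag_piP/winv_eqv/raag_eqv_repr. Qed.

Lemma raag_mulA : associative raag_mul.
Proof.
elim/quotW=> x; elim/quotW=> y; elim/quotW=> z.
by rewrite (raag_mulE y z) (raag_mulE x y) (raag_mulE x) raag_mulE catA.
Qed.

Lemma raag_mul1 : left_id raag_one raag_mul.
Proof. by elim/quotW=> x; rewrite (raag_mulE [::] x). Qed.

Lemma raag_mul1r : right_id raag_one raag_mul.
Proof. by elim/quotW=> x; rewrite (raag_mulE x [::]) cats0. Qed.

Lemma raag_mulVx : left_inverse raag_one raag_inv raag_mul.
Proof.
elim/quotW=> x; rewrite raag_invE raag_mulE.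
exact/eqP/raag_piP/winv_Vmul.
Qed.

Lemma raag_mulxV : right_inverse raag_one raag_inv raag_mul.
Proof.
elim/quotW=> x; rewrite raag_invE raag_mulE.
exact/eqP/raag_piP/winv_mulV.
Qed.

HB.instance Definition _ :=
  isGroup.Build raag raag_mulA raag_mul1 raag_mul1r raag_mulVx raag_mulxV.
End RAAG.

(** * First-order language of groups *)

(* [formula n] is the type of formulas with free variables among x_0, ...,
   x_(n-1).  A quantifier binds the variable ord0 of its body; the free
   variable i of the quantified formula is lift ord0 i in the body. *)
Inductive term (n : nat) : Type :=
| Var of 'I_n
| One
| Mul of term n & term n
| Inv of term n.

Inductive formula : nat -> Type :=
| Eq n of term n & term n : formula n
| Not n of formula n : formula n
| And n of formula n & formula n : formula n
| Or n of formula n & formula n : formula n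
| Imp n of formula n & formula n : formula n
| Forall n of formula n.+1 : formula n
| Exists n of formula n.+1 : formula n.

Definition sentence := formula 0.

Fixpoint eval (A : groupType) n (e : 'I_n -> A) (t : term n) : A :=
  match t with
  | Var i => e i
  | One => 1
  | Mul t1 t2 => eval e t1 * eval e t2
  | Inv t1 => (eval e t1)^-1
  end.

Definition env_cons (A : Type) n (a : A) (e : 'I_n -> A) : 'I_n.+1 -> A :=
  fun i => if unlift ord0 i is Some j then e j else a.

Fixpoint holds (A : groupType) n (f : formula n) : ('I_n -> A) -> Prop :=
  match f in formula m return ('I_m -> A) -> Prop with
  | Eq _ t1 t2 => fun e => eval e t1 = eval e t2
  | Not _ f1 => fun e => ~ holds f1 e
  | And _ f1 f2 => fun e => holds f1 e /\ holds f2 e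
  | Or _ f1 f2 => fun e => holds f1 e \/ holds f2 e
  | Imp _ f1 f2 => fun e => holds f1 e -> holds f2 e
  | Forall _ f1 => fun e => forall a : A, holds f1 (env_cons a e)
  | Exists _ f1 => fun e => exists a : A, holds f1 (env_cons a e)
  end.

Definition satisfies (A : groupType) (f : sentence) : Prop :=
  forall e : 'I_0 -> A, holds f e.

Definition elementary_equiv (A B : groupType) : Prop :=
  forall f : sentence, satisfies A f <-> satisfies B f.

(* Main.v *)
From HB Require Import structures.
Require Import Defs.
From mathcomp Require Import all_boot.
From mathcomp Require Import boolp.

(* The vertices of a graph are compared through the relation "equal or
   adjacent" and its polarity [polar] on sets of vertices.  Call a set of
   vertices essential when it is closed and no vertex of its center (its
   intersection with its polar) is weak.  An essential set is an intersection
   of sets [star v] (v not weak) and [link v] (v weak), and the essential sets,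
   ordered by inclusion, with the polarity and the sizes of the centers,
   determine the graph left after the removal of all superfluous weak vertices.
   This graph has the same core as the original one, since cores are unique up
   to isomorphism.

   In the group, write CC x z when some conjugate of x commutes with z.  For an
   essential set K, the elements conjugate into the subgroup generated by K
   are those z with CC v z for all vertices v in the polar of K.  Conversely,
   let x be a tuple of elements of such a group, put N = {z | CC x_i z for all
   i}, and suppose that no z in N with CC z z' for all z' in N has a centralizer
   like that of a weak vertex ("bad" below); then N is the set attached to an
   essential set K of the graph.  This rests on a description of centralizers,
   obtained from the retractions onto the subgroups generated by sets of
   vertices and from the kernel of the retraction killing a vertex v, which is
   free on conjugates of v.  Hence a first-order sentence true in one group
   yields an embedding of its essential sets into those of the other one, and
   by symmetry the two structures of essential sets are isomorphic. *)

Set Implicit Arguments.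
Unset Strict Implicit.
Unset Printing Implicit Defensive.

Local Open Scope group_scope.
Local Open Scope quotient_scope.

(** * Retractions and supports in right-angled Artin groups *)

Section Commute.
Variable T : groupType.
Implicit Types x y z g : T.

Lemma commuteJ x y g : commute x y -> commute (x ^ g) (y ^ g).
Proof. by move=> c; rewrite /commute -!conjMg c. Qed.

Lemma commute_conjC x y g : commute (x ^ g) y -> commute x (y ^ g^-1).
Proof. by move/(commuteJ g^-1); rewrite conjgK. Qed.

Lemma commuteMl x y z : commute x z -> commute y z -> commute (x * y) z.
Proof. by move=> /commute_sym xz /commute_sym yz; apply/commute_sym/commuteM. Qed.

Lemma commuteVl x y : commute x y -> commute x^-1 y.
Proof. by move/commute_sym/commuteV/commute_sym. Qed.

Lemma commute_conj x y : commute x y -> x ^ y = x.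
Proof. by move=> c; apply/conjg_fixP/commgP. Qed.
End Commute.

Section Retraction.
Variable G : graph.
Implicit Types (K L : {set G}) (x y z g : raag G) (u v w : G).

Definition gen v : raag G := \pi_(raag G) [:: (v, true)].

Definition lgen (l : G * bool) : raag G := \pi_(raag G) [:: l].

Lemma lgenE v b : lgen (v, b) = if b then gen v else (gen v)^-1.
Proof. by case: b => //; rewrite /gen [_^-1]raag_invE. Qed.

Lemma raag_wind (P : raag G -> Prop) :
  P 1 -> (forall l x, P x -> P (lgen l * x)) -> forall x, P x.
Proof.
move=> P1 PM; elim/quotW; elim=> [//|l u IH].
by have := PM l _ IH; rewrite [_ * _]raag_mulE.
Qed.

Lemma gen_adj u v : adj u v -> commute (gen u) (gen v).
Proof.
by move=> uv; rewrite /commute ![_ * _]raag_mulE; apply/eqP/raag_piP/raag_comm.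
Qed.

Definition restr K (u : word G) : word G := [seq l <- u | l.1 \in K].

Lemma restr_eqv K (u v : word G) : raag_eqv u v -> raag_eqv (restr K u) (restr K v).
Proof.
elim=> {u v}.
- by move=> u; apply: raag_refl.
- by move=> u v _; apply: raag_sym.
- by move=> u v w _ uv _; apply: raag_trans.
- by move=> u u' v v' _ uu' _ vv'; rewrite /restr !filter_cat; apply: raag_cat.
- move=> x b; rewrite /restr /=; case: (x \in K); [exact: raag_cancel | exact: raag_refl].
- move=> x y xy; rewrite /restr /=.
  by case: (x \in K); case: (y \in K); (apply: raag_comm || apply: raag_refl).
Qed.

Definition rho K x : raag G := \pi_(raag G) (restr K (repr x)).

Lemma rho_pi K (u : word G) : rho K (\pi_(raag G) u) = \pi_(raag G) (restr K u).
Proof. by apply/eqP/raag_piP/restr_eqv/raag_eqv_repr. Qed.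

Lemma rhoM K : {morph rho K : x y / x * y}.
Proof.
elim/quotW=> u; elim/quotW=> v.
by rewrite [_ * _]raag_mulE !rho_pi [RHS]raag_mulE /restr filter_cat.
Qed.

Lemma rho1 K : rho K 1 = 1.
Proof. exact: (rho_pi K [::]). Qed.

HB.instance Definition _ K :=
  isMultiplicative.Build (raag G) (raag G) (rho K) (rhoM K).
HB.instance Definition _ K :=
  Multiplicative_isUMagmaMorphism.Build (raag G) (raag G) (rho K) (rho1 K).

Lemma rhoV K : {morph rho K : x / x^-1}. Proof. exact: gmulfV. Qed.
Lemma rhoJ K : {morph rho K : x y / x ^ y}. Proof. exact: gmulfJ. Qed.

Lemma rho_gen K v : rho K (gen v) = if v \in K then gen v else 1.
Proof. by rewrite /gen rho_pi /restr /=; case: (v \in K). Qed.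

Lemma rho_lgen K l : rho K (lgen l) = if l.1 \in K then lgen l else 1.
Proof. by rewrite /lgen rho_pi /restr /=; case: (l.1 \in K). Qed.

Lemma rho_rho K L x : rho K (rho L x) = rho (K :&: L) x.
Proof.
elim/quotW: x => u; rewrite (rho_pi L) !rho_pi /restr -filter_predI.
congr (\pi_(raag G) _); by apply: eq_filter => l; rewrite inE /= ?inE.
Qed.

(** Membership in the subgroup generated by [K], encoded as being fixed by the retraction [rho K],
    which deletes the letters outside [K]. *)
Definition inA K x := rho K x == x.

Lemma inAP K x : reflect (rho K x = x) (inA K x).
Proof. exact: eqP. Qed.

Lemma inA_rho K x : inA K (rho K x).
Proof. by rewrite /inA rho_rho setIid. Qed.

Lemma inA_rhoI K L x : inA L x -> inA (K :&: L) (rho K x).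
Proof. by move=> /inAP <-; rewrite rho_rho inA_rho. Qed.

Lemma inAI K L x : inA K x -> inA L x -> inA (K :&: L) x.
Proof. by move=> /inAP Kx /inAP Lx; rewrite /inA -rho_rho Lx Kx. Qed.

Lemma inAS K L x : K \subset L -> inA K x -> inA L x.
Proof. by move=> /setIidPr KL /inAP <-; rewrite /inA rho_rho KL. Qed.

Lemma inA1 K : inA K 1. Proof. by rewrite /inA rho1. Qed.

Lemma inAM K x y : inA K x -> inA K y -> inA K (x * y).
Proof. by rewrite /inA rhoM => /eqP-> /eqP->. Qed.

Lemma inAV K x : inA K x -> inA K x^-1.
Proof. by rewrite /inA rhoV => /eqP->. Qed.

Lemma inAJ K x y : inA K x -> inA K y -> inA K (x ^ y).
Proof. by move=> Kx Ky; rewrite conjgE !inAM ?inAV. Qed.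

Lemma inAX K x n : inA K x -> inA K (x ^+ n).
Proof. by move=> Kx; elim: n => [|n IH]; rewrite ?inA1 // expgS inAM. Qed.

Lemma inAT x : inA setT x.
Proof.
by elim/quotW: x => u; rewrite /inA rho_pi /restr (eq_filter (a2 := predT)) ?filter_predT // => l; rewrite inE.
Qed.

Lemma inA_gen v K : v \in K -> inA K (gen v).
Proof. by move=> vK; rewrite /inA rho_gen vK. Qed.

Lemma inA0 x : inA set0 x -> x = 1.
Proof.
move/inAP <-; elim/quotW: x => u.
by rewrite rho_pi /restr (eq_filter (a2 := pred0)) ?filter_pred0 // => l; rewrite inE.
Qed.

Lemma inA_wind K (P : raag G -> Prop) :
  P 1 -> (forall l x, l.1 \in K -> P x -> P (lgen l * x)) ->
  forall x, inA K x -> P x.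
Proof.
move=> P1 PM x /inAP <-; elim/raag_wind: x => [|l x IH]; first by rewrite rho1.
by rewrite rhoM rho_lgen; case: ifP => [lK|_]; [apply: PM | rewrite mul1g].
Qed.

Definition joined K L := forall u v, u \in K -> v \in L -> u = v \/ adj u v.

Lemma joined_sym K L : joined K L -> joined L K.
Proof. by move=> KL u v uL vK; rewrite adj_sym; case: (KL v u) => //; [left|right]. Qed.

Lemma joinedS K K' L L' : K' \subset K -> L' \subset L -> joined K L -> joined K' L'.
Proof. by move=> /subsetP sK /subsetP sL KL u v /sK uK /sL vL; apply: KL. Qed.

Lemma commute_joined K L x y : joined K L -> inA K x -> inA L y -> commute x y.
Proof.
move=> KL Kx Ly; elim/inA_wind: Kx => [|[u b] {}x /= uK IH].
  exact/commute_sym/commute1.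
apply: commuteMl IH; elim/inA_wind: Ly => [|[v c] {}y /= vL IH]; first exact: commute1.
apply: commuteM IH; rewrite !lgenE.
have uv : commute (gen u) (gen v) by case: (KL u v uK vL) => [->//|/gen_adj].
by case: b; case: c; do ?[exact: uv | apply: commuteVl | apply: commuteV].
Qed.

Lemma rhoU K L x : joined K L -> [disjoint K & L] ->
  rho (K :|: L) x = rho K x * rho L x.
Proof.
move=> KL dKL; elim/raag_wind: x => [|l x IH]; first by rewrite !rho1 mulg1.
rewrite !rhoM IH !rho_lgen inE.
case: ifPn => [|/norP[/negPf-> /negPf->]]; last by rewrite !mul1g.
case lK: (l.1 \in K) => /= lL; first by rewrite (disjointFr dKL lK) mul1g mulgA.
rewrite lL mul1g !mulgA; congr (_ * _).
apply/commute_sym/(commute_joined KL (inA_rho _ _)).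
by case: l lK lL => v [] /= _ vL; rewrite /inA rho_lgen vL.
Qed.

(** ** Conjugates of standard parabolic subgroups *)

Definition cin K x := `[< exists g, inA K (x ^ g) >].

Lemma cinP K x : reflect (exists g, inA K (x ^ g)) (cin K x).
Proof. exact: asboolP. Qed.

Lemma inA_cin K x : inA K x -> cin K x.
Proof. by move=> Kx; apply/cinP; exists 1; rewrite conjg1. Qed.

Lemma cinJ K x g : cin K (x ^ g) = cin K x.
Proof.
apply/cinP/cinP => -[h Kh]; first by exists (g * h); rewrite conjgM.
by exists (g^-1 * h); rewrite conjgM conjgK.
Qed.

Lemma cin_inA K L x : inA L x -> cin K x -> exists2 g, inA L g & inA (K :&: L) (x ^ g).
Proof.
move=> Lx /cinP[g Kg]; exists (rho L g); first exact: inA_rho.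
by rewrite -[x in x ^ _](inAP _ _ Lx) -rhoJ setIC inA_rhoI.
Qed.

(* Retracting onto [L] turns a conjugate of [x] in [K] into one in [K :&: L],
   since a conjugate of [x] in [L] is fixed. *)
Lemma cinI K L x : cin K x -> cin L x -> cin (K :&: L) x.
Proof.
move=> cK /cinP[h Lh]; rewrite -(cinJ _ _ h); rewrite -(cinJ _ _ h) in cK.
by have [g _ Kg] := cin_inA Lh cK; apply/cinP; exists g.
Qed.

Lemma cinS K L x : K \subset L -> cin K x -> cin L x.
Proof. by move=> KL /cinP[g Kg]; apply/cinP; exists g; apply: inAS KL Kg. Qed.

Definition supp x := \bigcap_(K | inA K x) K.
(** By [cinI] the family is closed under intersection, so this is its least member: the support of a
    cyclically reduced conjugate of [x]. *)
Definition csupp x := \bigcap_(K | cin K x) K.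

Lemma inA_supp K x : inA K x = (supp x \subset K).
Proof.
apply/idP/idP => [Kx|]; first exact: bigcap_inf.
move=> sK; apply: inAS sK _.
by rewrite /supp; elim/big_ind: _ => // [|K1 K2]; [apply: inAT | apply: inAI].
Qed.

Lemma cin_csupp K x : cin K x = (csupp x \subset K).
Proof.
apply/idP/idP => [Kx|]; first exact: bigcap_inf.
move=> sK; apply: cinS sK _.
by rewrite /csupp; elim/big_ind: _ => // [|K1 K2]; [apply/inA_cin/inAT | apply: cinI].
Qed.

Lemma csuppJ x g : csupp (x ^ g) = csupp x.
Proof. by apply: eq_bigl => K; rewrite cinJ. Qed.

Lemma csupp_conj x : exists g, inA (csupp x) (x ^ g).
Proof. by apply/cinP; rewrite cin_csupp. Qed.

Lemma csupp_inA K x : inA K x -> csupp x \subset K.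
Proof. by rewrite -cin_csupp; apply: inA_cin. Qed.

Lemma csupp_conj_in K x : inA K x -> exists2 g, inA K g & inA (csupp x) (x ^ g).
Proof.
move=> Kx; have cx : cin (csupp x) x by rewrite cin_csupp.
by have [g Kg] := cin_inA Kx cx; rewrite (setIidPl (csupp_inA Kx)); exists g.
Qed.

Lemma csupp_eq0 x : csupp x = set0 -> x = 1.
Proof. by have [g] := csupp_conj x => + e; rewrite e => /inA0/eqP; rewrite conjg_eq1 => /eqP. Qed.

Lemma csupp1 : csupp 1 = set0.
Proof. by apply/eqP; rewrite -subset0 csupp_inA ?inA1. Qed.

(** The exponent sum of [v] modulo 2: a homomorphism, hence blind to conjugation and to squares. *)
Definition parity v x : bool := odd (count (fun l : G * bool => l.1 == v) (repr x)).

Lemma parity_pi v (u : word G) :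
  parity v (\pi_(raag G) u) = odd (count (fun l : G * bool => l.1 == v) u).
Proof.
rewrite /parity; move: (repr _) (raag_eqv_repr u) => w; elim=> {u w} //.
- by move=> u w t _ -> _.
- by move=> u u' w w' _ e1 _ e2; rewrite !count_cat !oddD e1 e2.
- by move=> x b /=; case: (x == v).
- by move=> x y _ /=; rewrite !addn0 addnC.
Qed.

Lemma parityM v x y : parity v (x * y) = parity v x (+) parity v y.
Proof.
elim/quotW: x => a; elim/quotW: y => b.
by rewrite [_ * _]raag_mulE !parity_pi count_cat oddD.
Qed.

Lemma parity1 v : parity v 1 = false.
Proof. exact: (parity_pi v [::]). Qed.

Lemma parityV v x : parity v x^-1 = parity v x.
Proof.
by have := parityM v x^-1 x; rewrite mulVg parity1; do 2!case: (parity v _).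
Qed.

Lemma parityJ v x g : parity v (x ^ g) = parity v x.
Proof. by rewrite conjgE !parityM parityV addbCA addbb addbF. Qed.

Lemma parity_gen v u : parity v (gen u) = (u == v).
Proof. by rewrite parity_pi /= addn0 oddb. Qed.

Lemma parity_notin v K x : inA K x -> v \notin K -> parity v x = false.
Proof.
move=> Kx vK; elim/inA_wind: Kx => [|[u b] {}x /= uK IH]; first exact: parity1.
rewrite parityM IH parity_pi /= addn0 oddb; apply/negbTE.
by apply: contra vK; rewrite addbF => /eqP <-.
Qed.

Lemma csupp_gen v : csupp (gen v) = [set v].
Proof.
apply/eqP; rewrite eqEsubset csupp_inA ?inA_gen ?set11 //= sub1set.
apply: contraT => vn; have [g] := csupp_conj (gen v).
by move=> /parity_notin/(_ vn); rewrite parityJ parity_gen eqxx.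
Qed.
End Retraction.

(** * Free reduction and the action of a vertex *)

Section FreeReduction.
Variable T : eqType.
Implicit Types (l : T * bool) (p q r t w : seq (T * bool)).

Definition linv l := (l.1, ~~ l.2).

Lemma linvK : involutive linv.
Proof. by case=> x b; rewrite /linv /= negbK. Qed.

Definition reduced w := sorted (fun l m => m != linv l) w.

Definition push l w :=
  if w is m :: w' then if m == linv l then w' else l :: w else [:: l].

Definition rprod p q := foldr push q p.

Lemma reduced_behead l w : reduced (l :: w) -> reduced w.
Proof. exact: path_sorted. Qed.

Lemma push_reduced l w : reduced w -> reduced (push l w).
Proof.
case: w => [//|m w] /= mw; case: eqP => [_|/eqP ml]; first exact: path_sorted mw.
by rewrite /= ml.
Qed.

Lemma pushK l w : reduced w -> push (linv l) (push l w) = w.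
Proof.
case: w => [|m w] /=; first by rewrite linvK eqxx.
case: eqP => [->|_]; last by rewrite /= linvK eqxx.
by case: w => [//|m' w] /= /andP[/negPf->].
Qed.

Lemma push_head l p : reduced (l :: p) -> push l p = l :: p.
Proof. by case: p => //= m p /andP[/negPf->]. Qed.

Lemma rprod_reduced p q : reduced q -> reduced (rprod p q).
Proof. by move=> rq; elim: p => //= l p; apply: push_reduced. Qed.

Lemma rprod_push l p q : reduced q -> rprod (push l p) q = push l (rprod p q).
Proof.
move=> rq; case: p => //= m p; case: eqP => //= ->.
by rewrite -{1}[l]linvK pushK //; apply: rprod_reduced.
Qed.

Lemma rprod_cat p q : reduced (p ++ q) -> rprod p q = p ++ q.
Proof.
elim: p => //= l p IH lpq.
by rewrite IH ?push_head //; apply: path_sorted lpq.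
Qed.

Lemma rprod_nil p : reduced p -> rprod p [::] = p.
Proof. by move=> rp; rewrite rprod_cat cats0. Qed.

Lemma rprod_cancel p q : reduced p -> exists i,
  [/\ i <= size p, i <= size q & rprod p q = take (size p - i) p ++ drop i q].
Proof.
elim: p => [|l p IH] rp; first by exists 0; rewrite /= drop0.
have [i [ip iq e]] := IH (reduced_behead rp); rewrite /= e.
have [lt_ip|] := ltnP i (size p).
  exists i; split=> //; first exact: leqW.
  rewrite subSn // /=; case: p rp ip lt_ip {IH e} => [//|m p] /= /andP[lm _] _ lt_ip.
  by rewrite subSn //= (negPf lm).
move=> lepi; have ei : size p = i; first by apply/eqP; rewrite eqn_leq lepi ip.
subst i; rewrite subnn take0 /=.
case eq: (drop _ q) => [|m q'] /=.
  by exists (size p); rewrite subSnn eq /= take0; split.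
have lt_pq : size p < size q by rewrite ltnNge; apply/negP => /drop_oversize; rewrite eq.
have eq' : drop (size p).+1 q = q' by rewrite -addn1 addnC -drop_drop eq /= drop0.
case: ifP => _; first by exists (size p).+1; rewrite subnn eq'.
by exists (size p); rewrite subSnn eq /= take0; split.
Qed.

Lemma rprod_extend p q t : size p <= size q -> rprod p (q ++ t) = rprod p q ++ t.
Proof.
(* Each letter of [p] uses up at most one letter of [q]; [m] bounds from below what is left, so [t]
   is never reached. *)
have H m : m + size p <= size q -> rprod p (q ++ t) = rprod p q ++ t /\ m <= size (rprod p q).
  elim: p m => [|l p IH] m; first by rewrite addn0.
  rewrite /= addnS -addSn => /IH[->]; case: (rprod p q) => //= a w mw.
  by case: ifP => _; split=> //=; rewrite ltnS in mw; rewrite ?leqW.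
by move=> pq; have [] := H 0 pq.
Qed.
Lemma rprod_inj p q r : reduced q -> reduced r -> rprod p q = rprod p r -> q = r.
Proof.
move=> rq rr; elim: p => //= l p IH /(congr1 (push (linv l))).
by rewrite !pushK ?rprod_reduced.
Qed.

Lemma rprod_take p q : reduced p -> prefix (take (size p - size q) p) (rprod p q).
Proof.
move=> rp; have [i [_ iq ->]] := rprod_cancel q rp.
apply: prefix_catl; rewrite -(@take_takel _ (size p - size q) (size p - i)) ?leq_sub2l //.
exact: prefix_take.
Qed.
End FreeReduction.

Section FreeAction.
Variables (G : graph) (v : G).
Implicit Types (x y z g k : raag G) (u w : word G).

Notation coset := (raag G -> Prop).
Notation L := (link v).
Notation B := (~: [set v]).

Definition transl x (c : coset) : coset := fun b => c (x^-1 * b).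
Definition coset0 : coset := fun b => inA L b.

Lemma transl1 c : transl 1 c = c.
Proof. by apply/funext => b; rewrite /transl invg1 mul1g. Qed.

Lemma translM x y c : transl (x * y) c = transl x (transl y c).
Proof. by apply/funext => b; rewrite /transl invgM mulgA. Qed.

Lemma translK x : cancel (transl x) (transl x^-1).
Proof. by move=> c; rewrite -translM mulVg transl1. Qed.

Lemma transl_inj x : injective (transl x).
Proof. exact: can_inj (translK x). Qed.

Lemma transl_coset0 x : transl x coset0 = coset0 <-> inA L x.
Proof.
split=> [e|Lx].
  have : coset0 1 by rewrite /coset0 inA1.
  by rewrite -e /transl mulg1 => /inAV; rewrite invgK.
apply/funext => b; apply/propext; rewrite /transl /coset0; split=> Lb; last exact/inAM/Lb/inAV.
by rewrite -[b](mulKg x^-1) invgK inAM.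
Qed.

Definition wtransl x (s : seq (coset * bool)) := [seq (transl x l.1, l.2) | l <- s].

Lemma wtransl1 s : wtransl 1 s = s.
Proof. by rewrite /wtransl map_id_in // => -[c b] _; rewrite transl1. Qed.

Lemma wtranslM x y s : wtransl (x * y) s = wtransl x (wtransl y s).
Proof. by rewrite /wtransl -map_comp; apply: eq_map => l; rewrite /= translM. Qed.

Lemma wtransl_push x l s : wtransl x (push l s) = push (transl x l.1, l.2) (wtransl x s).
Proof.
case: s => [//|[c b] s]; rewrite /= /linv !xpair_eqE /= (inj_eq (@transl_inj x)).
by case: ifP.
Qed.

Lemma wtransl_reduced x s : reduced s -> reduced (wtransl x s).
Proof.
case: s => //= l s; elim: s l => //= m s IH l /andP[lm ms].
rewrite IH // andbT; apply: contra lm; rewrite /linv !xpair_eqE /=.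
by rewrite (inj_eq (@transl_inj x)).
Qed.

Lemma wtransl_rprod x p q :
  wtransl x (rprod p q) = rprod (wtransl x p) (wtransl x q).
Proof. by elim: p => //= l p <-; rewrite wtransl_push. Qed.

(* The group acts on reduced words over the left cosets of the link subgroup:
   [v] multiplies on the left by the trivial coset, the other vertices
   translate all the cosets.  The kernel of the retraction killing [v] is free
   on the conjugates of [v], which these cosets index. *)
Definition act_letter (l : G * bool) s :=
  if l.1 == v then push (coset0, l.2) s else wtransl (lgen l) s.

Definition act u s := foldr act_letter s u.

Lemma act_reduced u s : reduced s -> reduced (act u s).
Proof.
move=> rs; elim: u => //= l u IH; rewrite /act_letter.
by case: eqP => _; [apply: push_reduced | apply: wtransl_reduced].
Qed.

(** Generators of the link of [v] fix the trivial coset, so that their translations commute with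
    multiplication by it. *)
Lemma act_letter_comm (x y : G) s : adj x y ->
  act_letter (x, true) (act_letter (y, true) s) =
  act_letter (y, true) (act_letter (x, true) s).
Proof.
have H (z : G) t : adj v z -> push (coset0, true) (wtransl (gen z) t) =
                          wtransl (gen z) (push (coset0, true) t).
  move=> vz; rewrite wtransl_push /=; congr (push (_, _) _); apply/esym.
  by apply/transl_coset0/inA_gen; rewrite inE.
rewrite /act_letter /= !lgenE; case: eqP => [->|_]; case: eqP => [->|_] //.
- by move=> vy; rewrite H.
- by rewrite adj_sym => vx; rewrite H.
- by move=> xy; rewrite -!wtranslM (gen_adj xy).
Qed.

Lemma act_eqv u w : raag_eqv u w -> forall s, reduced s -> act u s = act w s.
Proof.
elim=> {u w} [//|u w _ IH s rs|u w t _ IH1 _ IH2 s rs|u u' w w' _ IH1 _ IH2 s rs|x b s rs|x y xy s rs].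
- by rewrite IH.
- by rewrite IH1 ?IH2.
- by rewrite /act !foldr_cat -/(act _ _) -/(act _ _) -/(act _ _) -/(act _ _) IH2 // IH1 // act_reduced.
- rewrite /= /act_letter /=; case: eqP => [_|_].
    by rewrite -{1}[b]negbK; apply: (pushK (coset0, ~~ b)).
  rewrite -wtranslM !lgenE.
  by case: b => /=; rewrite ?mulgV ?mulVg wtransl1.
- exact: act_letter_comm.
Qed.

(** This word records the component of [x] in the kernel of [rho B]; the other component is
    [rho B x]. *)
Definition fword x := act (repr x) [::].

Lemma fword_pi u : fword (\pi_(raag G) u) = act u [::].
Proof. by rewrite /fword (act_eqv (raag_eqv_repr u)). Qed.

Lemma fword_reduced x : reduced (fword x).
Proof. exact: act_reduced. Qed.

Lemma act_rprod u s : reduced s ->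
  act u s = rprod (act u [::]) (wtransl (rho B (\pi_(raag G) u)) s).
Proof.
move=> rs; elim: u => [|l u /= ->].
  by rewrite -[rho _ _]/(rho B 1) rho1 wtransl1.
have -> : rho B (\pi_(raag G) (l :: u)) = rho B (lgen l) * rho B (\pi_(raag G) u).
  by rewrite -rhoM [_ * _]raag_mulE.
rewrite rho_lgen !inE /act_letter; case: eqP => _ /=.
  by rewrite mul1g rprod_push //; apply: wtransl_reduced.
by rewrite wtransl_rprod wtranslM.
Qed.

(** A cocycle identity: the group is the semidirect product of the kernel and the subgroup of [B],
    which translates the letters. *)
Lemma fwordM x y : fword (x * y) = rprod (fword x) (wtransl (rho B x) (fword y)).
Proof.
elim/quotW: x => u; elim/quotW: y => w.
by rewrite [_ * _]raag_mulE !fword_pi -act_rprod ?act_reduced // /act foldr_cat.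
Qed.

Lemma fword1 : fword 1 = [::].
Proof. exact: (fword_pi [::]). Qed.

Lemma fword_dec x : exists s : seq (raag G * bool),
  [/\ fword x = [seq (transl p.1 coset0, p.2) | p <- s],
      all (fun p => inA B p.1) s
    & x = (\prod_(p <- s) lgen (v, p.2) ^ p.1^-1) * rho B x].
Proof.
elim/raag_wind: x => [|l x [s [sF sB sx]]].
  by exists [::]; rewrite fword1 big_nil rho1 mulg1.
have -> : fword (lgen l * x) = act_letter l (fword x).
  by elim/quotW: {s sF sB sx} x => u; rewrite [_ * _]raag_mulE !fword_pi.
rewrite rhoM rho_lgen !inE /act_letter sF {1}sx mulgA; case: eqP => [lv|/eqP nlv] /=; last first.
  exists [seq (lgen l * p.1, p.2) | p <- s]; split.
  - by rewrite /wtransl -!map_comp; apply: eq_map => p; rewrite /= translM.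
  - rewrite all_map; apply: sub_all sB => p; apply: inAM.
    by rewrite /inA rho_lgen !inE nlv.
  rewrite big_map mulgA; congr (_ * _); rewrite conjgCV conjg_prod; congr (_ * _).
  by apply: eq_bigr => p _; rewrite -conjgM invgM.
case: l lv => _ b /= ->; rewrite mul1g.
have caseN : exists s' : seq (raag G * bool),
    [/\ (coset0, b) :: [seq (transl p.1 coset0, p.2) | p <- s] =
        [seq (transl p.1 coset0, p.2) | p <- s'],
        all (fun p => inA B p.1) s' & lgen (v, b) * (\prod_(p <- s) lgen (v, p.2) ^ p.1^-1) * rho B x =
    (\prod_(p <- s') lgen (v, p.2) ^ p.1^-1) * rho B x].
  by exists ((1, b) :: s); rewrite /= transl1 inA1 big_cons /= invg1 conjg1.
case: s {sF sx} sB caseN => //= -[y c] s /andP[_ sB] caseN; case: ifP => //=.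
(* Two letters cancel when their cosets agree and their signs differ. Then [y] lies in the link
   subgroup and commutes with [v], so the corresponding factors cancel as well. *)
rewrite /linv xpair_eqE => /andP[/eqP/transl_coset0 Ly /eqP -> /=]; exists s; split=> //.
rewrite big_cons /= commute_conj; last first.
  apply/commuteV/(@commute_joined _ [set v] L); rewrite ?inA_gen ?set11 //.
    by move=> a d /set1P-> ; rewrite inE; right.
  by rewrite /inA rho_lgen set11.
rewrite mulgA !lgenE; congr (_ * _).
by case: b {caseN} => /=; rewrite ?mulgV ?mulVg mul1g.
Qed.

Lemma fword_nil x : fword x = [::] <-> inA B x.
Proof.
split=> [e|/inAP <-].
  have [[|p s] [+ _ ->]] := fword_dec x; last by rewrite e.
  by rewrite big_nil mul1g inA_rho.
elim/quotW: x => u; rewrite rho_pi fword_pi; elim: u => //= l u IH.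
by rewrite !inE; case: eqP => //= /eqP/negPf lv; rewrite /act_letter lv IH.
Qed.

Lemma fword_inA x : inA B x -> fword x = [::].
Proof. by move/fword_nil. Qed.

Lemma size_wtransl x s : size (wtransl x s) = size s.
Proof. exact: size_map. Qed.

(* If [h] commutes with [x], then [x] permutes the cosets of the free word of
   [h]; as this word is fixed, [x] fixes each of its letters. *)
Lemma commute_cin_link x h : inA B x -> commute h x -> ~~ inA B h -> cin L x.
Proof.
move=> Bx hx nBh; have [[|[y b] s] [Fh _ _]] := fword_dec h.
  by case/negP: nBh; apply/fword_nil.
have: fword (x * h) = fword (h * x) by rewrite hx.
rewrite !fwordM (fword_inA Bx) /= rprod_nil ?fword_reduced // (inAP _ _ Bx) Fh.
move=> [+ _]; rewrite -translM => e.
apply/cinP; exists y; apply/transl_coset0.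
apply: (@transl_inj y); by rewrite -translM conjgE mulVKg.
Qed.

End FreeAction.

Lemma reduced_cat (T : eqType) a b (p q : seq (T * bool)) :
  reduced ((a :: p) ++ b :: q) =
  [&& reduced (a :: p), b != linv (last a p) & reduced (b :: q)].
Proof. by rewrite /reduced /= cat_path. Qed.

Lemma prefix_size_prefix (T : eqType) (p q w : seq T) :
  prefix p w -> prefix q w -> size p <= size q -> prefix p q.
Proof.
rewrite !prefixE => /eqP pw /eqP qw pq.
by rewrite -qw take_takel // pw.
Qed.

(** * Translation lengths and cyclic centralizers *)

Section Cyclic.
Variables (G : graph) (v : G).
Implicit Types (x y z g k : raag G).

Notation B := (~: [set v]).
Notation F := (@fword G v).
Notation len x := (size (F x)).

Lemma fword_lgen b : F (lgen (v, b)) = [:: (@coset0 G v, b)].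
Proof. by rewrite fword_pi /= /act_letter eqxx. Qed.

Lemma fword_len0V x y : F (x * y) = [::] -> len x = len y.
Proof.
rewrite fwordM; set q := wtransl _ _ => e.
have sq : size q = len y by rewrite size_wtransl.
have [i [ip iq]] := rprod_cancel q (fword_reduced v x).
rewrite e => /esym/(congr1 size)/eqP.
rewrite size_cat size_takel ?leq_subr // size_drop addn_eq0 !subn_eq0 -sq => /andP[h1 h2].
by apply/eqP; rewrite eqn_leq (leq_trans h1 iq) (leq_trans h2 ip).
Qed.

Lemma fwordV_len x : len x^-1 = len x.
Proof. by apply: fword_len0V; rewrite mulVg fword1. Qed.

Lemma fword_cancel k y r : F y = F k ++ r -> F (k^-1 * y) = wtransl (rho B k)^-1 r.
Proof.
move=> e; have rr : reduced (F k ++ r) by rewrite -e fword_reduced.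
have := fwordM v k (k^-1 * y); rewrite mulVKg e -rprod_cat // => /rprod_inj-> //.
- by rewrite -wtranslM mulVg wtransl1.
- by move: rr; rewrite /reduced; case: (F k) => //= a p; rewrite cat_path => /andP[_ /path_sorted].
- exact/wtransl_reduced/fword_reduced.
Qed.

(** An element of minimal length in its conjugacy class is cyclically reduced, in the sense twisted
    by [rho B x]; hence lengths of powers are additive. *)
Lemma fword_min_reduced x : (forall g, len x <= len (x ^ g)) ->
  reduced (F x ++ wtransl (rho B x) (F x)).
Proof.
move=> minx; have [[|[y b] s] [Fx yB _]] := fword_dec v x; first by rewrite Fx.
move: Fx yB => /=; set a := (_, b); set s' := map _ _ => Fx /andP[yB _].
have rW := wtransl_reduced (rho B x) (fword_reduced v x).
have eW : wtransl (rho B x) (F x) = (transl (rho B x) a.1, a.2) :: wtransl (rho B x) s'.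
  by rewrite Fx.
rewrite eW in rW *; rewrite {1}Fx reduced_cat -Fx fword_reduced rW andbT /=.
(* The free word of [t] is the first letter of [F x]. If there were a cancellation, [t] on the right
   would remove the last letter of [x], and [t^-1] on the left the first one, so [x ^ t] would be
   shorter. *)
apply/eqP => e; pose t := lgen (v, b) ^ y^-1.
have rt : rho B t = 1 by rewrite rhoJ rho_lgen !inE eqxx conj1g.
have Ft : F t = [:: a].
  rewrite /t conjgE invgK !fwordM (fword_inA yB) (fword_inA (inAV yB)) fword_lgen /=.
  by rewrite (inAP _ _ yB).
have FtV : F t^-1 = [:: linv a].
  rewrite /t -conjVg conjgE invgK !fwordM (fword_inA yB) (fword_inA (inAV yB)) /=.
  rewrite (_ : (lgen _)^-1 = lgen (v, ~~ b)) ?fword_lgen /= ?(inAP _ _ yB) //.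
  by rewrite !lgenE; case: (b); rewrite ?invgK.
have Fxt : F (x * t) = belast a s'.
  rewrite fwordM Ft Fx lastI /rprod foldr_rcons /= e /linv /= eqxx.
  rewrite -/(rprod _ _) rprod_nil //; have := fword_reduced v x.
  by rewrite Fx lastI -cats1 /reduced; case: (belast a s') => //= c p; rewrite cat_path => /andP[].
have := minx t; rewrite conjgE fwordM FtV rhoV rt invg1 wtransl1 Fxt Fx.
clear eW rW; case: s' Fx Fxt e => [|c s'] /= _ _ e.
  by move: e => /(congr1 snd) /=; case: (b).
rewrite linvK eqxx size_belast.
by rewrite ltnNge leqnSn.
Qed.

Section MinimalGenerator.
Variables (C : raag G -> Prop) (x : raag G).
Hypothesis CM : forall y z, C y -> C z -> C (y * z).
Hypothesis CV : forall y, C y -> C y^-1.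
Hypothesis Cx : C x.
Hypothesis Ccomm : forall y, C y -> commute y x.
Hypothesis Ccin : forall y, C y -> cin B y -> y = 1.
Hypothesis x_neq1 : x != 1.
Hypothesis minx : forall g, len x <= len (x ^ g).

Let CX y n : C y -> C (y ^+ n).
Proof.
move=> Cy; elim: n => [|n IH]; last by rewrite expgS; apply: CM.
by rewrite expg0 -(mulVg x); apply/CM/Cx/CV.
Qed.

Let len_gt0 : 0 < len x.
Proof.
rewrite lt0n size_eq0; apply: contraNneq x_neq1 => /fword_nil Bx.
exact/eqP/Ccin/inA_cin.
Qed.

Let fword_pow n : F (x ^+ n.+1) = F x ++ wtransl (rho B x) (F (x ^+ n)).
Proof.
elim: n => [|n IH]; first by rewrite expg1 expg0 fword1 cats0.
rewrite expgS fwordM rprod_cat //.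
have := fword_min_reduced minx; have := fword_reduced v (x ^+ n.+1); rewrite IH.
case: (F x) len_gt0 => [//|a s] _; set r := wtransl _ (F _); set z := rho B x => rn.
have eW p : wtransl z (a :: p) = (transl z a.1, a.2) :: wtransl z p by [].
rewrite eW reduced_cat => /and3P[ra na _].
by rewrite eW reduced_cat ra na -eW wtransl_reduced.
Qed.

Let len_pow n : len (x ^+ n) = (n * len x)%N.
Proof.
by elim: n => [|n IH]; rewrite ?expg0 ?fword1 // fword_pow size_cat size_wtransl IH mulSn.
Qed.

Let pow_prefix n m : n <= m -> prefix (F (x ^+ n)) (F (x ^+ m)).
Proof.
elim: n m => [|n IH] [|m] //; rewrite ?expg0 ?fword1 ?prefix0s // ltnS => /IH/prefixP[r e].
by rewrite !fword_pow e /wtransl map_cat catA prefix_prefix.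
Qed.

(** These are the elements whose free words lie along the positive half of the axis of [x]. *)
Let pre k := exists n, prefix (F k) (F (x ^+ n)).

(* Right multiplication by [k] alters only the last letters of a long power of [x]. *)
Let pow_conj_prefix y k n : C k -> size (F y) + len k <= n ->
  prefix (F y) (F (k * x ^+ n)) -> prefix (F y) (F (x ^+ n)).
Proof.
move=> Ck le_n yk.
have e : k * x ^+ n = x ^+ n * k by apply/commuteX/Ccomm.
have le_nx : n <= len (x ^+ n) by rewrite len_pow -{1}(muln1 n) leq_mul.
pose q := wtransl (rho B (x ^+ n)) (F k).
have := rprod_take q (fword_reduced v (x ^+ n)); rewrite -fwordM -e size_wtransl => h.
apply: prefix_trans (prefix_take _ (len (x ^+ n) - len k)).
apply: prefix_size_prefix yk h _.
rewrite size_takel ?leq_subr // leq_subRL; last by rewrite (leq_trans _ le_nx) // (leq_trans _ le_n) ?leq_addl.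
by rewrite addnC (leq_trans le_n).
Qed.

(** The words of [k1] and [k2] are prefixes of a common power and so nested. This is the division
    step of a Euclidean algorithm on lengths. *)
Let pre_div k1 k2 : C k1 -> C k2 -> pre k1 -> pre k2 -> len k2 <= len k1 ->
  pre (k2^-1 * k1) /\ len k1 = len k2 + len (k2^-1 * k1).
Proof.
move=> Ck1 Ck2 [n1 p1] [n2 p2] le21.
pose n := maxn (maxn n1 n2) (len (k2^-1 * k1) + len k2).
have q1 : prefix (F k1) (F (x ^+ n)).
  by apply: prefix_trans p1 (pow_prefix _); rewrite !leq_max leqnn.
have q2 : prefix (F k2) (F (x ^+ n)).
  by apply: prefix_trans p2 (pow_prefix _); rewrite !leq_max leqnn orbT.
have /prefixP[r e1] := prefix_size_prefix q2 q1 le21.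
have /prefixP[s en] := q1.
have ek := fword_cancel e1.
split; last by rewrite ek size_wtransl e1 size_cat.
exists n; apply: (@pow_conj_prefix _ k2^-1); first exact: CV.
  by rewrite fwordV_len leq_maxr.
have {}en : F (x ^+ n) = F k2 ++ (r ++ s) by rewrite en e1 catA.
by rewrite (fword_cancel en) ek /wtransl map_cat prefix_prefix.
Qed.

(** For exponents at least [len k], multiplying by [k] on the left alters only the first [len k]
    letters of the power, so the words of the products are nested; commuting [k] past the power puts
    them on the axis. *)
Let pre_shift k : C k -> exists n, pre (k * x ^+ n).
Proof.
move=> Ck; exists (len k).
pose n := len (k * x ^+ len k) + len k; exists n.
apply: (@pow_conj_prefix _ k) => //.
rewrite /n addnC expgnDr mulgA fwordM -/n.
set t := wtransl _ _.
have le1 : len k <= len (x ^+ len k) by rewrite len_pow -{1}(muln1 (len k)) leq_mul.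
have /prefixP[s es] : prefix (F (x ^+ len k)) (F (x ^+ n)).
  by apply: pow_prefix; rewrite leq_addl.
have := fwordM v k (x ^+ n); rewrite es /wtransl map_cat rprod_extend ?size_map //.
rewrite -/(wtransl _ _) -fwordM /n addnC expgnDr mulgA fwordM -/t => ->.
exact: prefix_prefix.
Qed.

Lemma cyclic_of_min : exists2 g, C g & forall k, C k -> exists n, k = g ^+ n \/ k = g ^- n.
Proof.
(* The generator is an element of [C] on the positive axis of least positive length. *)
have ex : exists n, `[< exists g, [/\ C g, pre g & len g = n.+1] >].
  exists (len x).-1; apply/asboolP; exists x; split=> //; last by rewrite prednK.
  by exists 1%N; rewrite expg1 prefix_refl.
case: (ex_minnP ex) => n /asboolP[g [Cg pg lg]] min_g.
have pow_g k : C k -> pre k -> exists j, k = g ^+ j.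
  have [m] := ubnP (len k); elim: m k => // m IH k; rewrite ltnS => le_km Ck pk.
  have [k0|k_gt0] := posnP (len k).
    exists 0; rewrite expg0; apply: Ccin => //; apply/inA_cin/fword_nil.
    by apply/eqP; rewrite -size_eq0 k0.
  have le_gk : len g <= len k.
    rewrite lg -(prednK k_gt0) ltnS; apply: min_g; apply/asboolP.
    by exists k; split=> //; rewrite prednK.
  have [pk' lk] := pre_div Ck Cg pk pg le_gk.
  have [||j e] := IH (g^-1 * k) _ _ pk'.
  - by rewrite (leq_trans _ le_km) // lk lg addSn ltnS leq_addl.
  - by apply/CM/Ck/CV.
  - by exists j.+1; rewrite expgS -e mulVKg.
have [j xj] : exists j, x = g ^+ j.
  by apply: pow_g => //; exists 1%N; rewrite expg1 prefix_refl.
(* A power of [x], itself a power of [g], moves [k] onto the positive axis; dividing by it again may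
   give a negative exponent. *)
exists g => // k Ck; have [m pk] := pre_shift Ck.
have [i ei] := pow_g _ (CM Ck (CX _ Cx)) pk.
have {ei} -> : k = g ^+ i * (g ^+ (j * m)%N)^-1 by rewrite -ei xj -expgnA mulgK.
have [le|/ltnW le] := leqP (j * m)%N i.
  by exists (i - j * m)%N; left; rewrite expgnFr.
by exists (j * m - i)%N; right; rewrite expgnFr // invgM invgK.
Qed.
End MinimalGenerator.

(* The group acts on the Bass-Serre tree of the splitting over the link of
   [v]; a group of elements preserving the axis of [x] and in which only the
   identity is elliptic embeds into the translations of that axis. *)
Lemma cyclic_of_cin (C : raag G -> Prop) x :
  (forall y z, C y -> C z -> C (y * z)) -> (forall y, C y -> C y^-1) -> C x ->
  (forall y, C y -> commute y x) -> (forall y, C y -> cin B y -> y = 1) -> x != 1 ->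
  exists2 g, C g & forall k, C k -> exists n, k = g ^+ n \/ k = g ^- n.
Proof.
move=> CM CV Cx Ccomm Ccin x1.
have ex : exists n, `[< exists g, len (x ^ g) = n >].
  by exists (len x); apply/asboolP; exists 1; rewrite conjg1.
case: (ex_minnP ex) => n /asboolP[g xg] min_g.
pose C' k := C (k ^ g^-1).
have [|||||||h Ch hP] := @cyclic_of_min C' (x ^ g).
- by move=> y z; rewrite /C' conjMg; apply: CM.
- by move=> y; rewrite /C' conjVg; apply: CV.
- by rewrite /C' conjgK.
- by move=> y /Ccomm/(commuteJ g); rewrite conjgKV.
- move=> y /Ccin; rewrite cinJ => h /h /eqP; by rewrite conjg_eq1 => /eqP.
- by rewrite conjg_eq1.
- by move=> t; rewrite xg; apply: min_g; apply/asboolP; exists (g * t); rewrite conjgM.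
exists (h ^ g^-1) => // k Ck; have [|m [e|e]] := hP (k ^ g); first by rewrite /C' conjgK.
- by exists m; left; rewrite -conjXg -e conjgK.
- by exists m; right; rewrite -conjXg -conjVg -e conjgK.
Qed.
End Cyclic.

(** * Polars of sets of vertices *)

Section Polar.
Variable G : graph.
Implicit Types (K L S T U : {set G}) (u v w : G).

Lemma mem_star u v : (u \in star v) = (u == v) || adj v u.
Proof. by rewrite !inE. Qed.

Lemma mem_starC u v : (u \in star v) = (v \in star u).
Proof. by rewrite !mem_star eq_sym adj_sym. Qed.

Lemma star_refl v : v \in star v. Proof. by rewrite mem_star eqxx. Qed.

Lemma link_star v : link v \subset star v. Proof. exact: subsetUr. Qed.

Lemma notin_link v : v \notin link v. Proof. by rewrite inE adj_irr. Qed.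

Definition polar K := [set u | K \subset star u].

Lemma polarP K u : reflect (forall k, k \in K -> k \in star u) (u \in polar K).
Proof. by rewrite inE; apply: subsetP. Qed.

Lemma polar_subC K L : (K \subset polar L) = (L \subset polar K).
Proof.
apply/subsetP/subsetP => KL u uK; apply/polarP => w /KL/polarP/(_ _ uK);
by rewrite mem_starC.
Qed.

Lemma sub_bipolar K : K \subset polar (polar K).
Proof. by rewrite polar_subC. Qed.

Lemma polarS K L : K \subset L -> polar L \subset polar K.
Proof. by move=> KL; rewrite polar_subC (subset_trans KL) ?sub_bipolar. Qed.

Lemma polar3 K : polar (polar (polar K)) = polar K.
Proof. by apply/eqP; rewrite eqEsubset sub_bipolar polarS ?sub_bipolar. Qed.

Lemma polar1 v : polar [set v] = star v.
Proof. by apply/setP => u; rewrite inE sub1set mem_starC. Qed.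

Lemma sub_polar_star K v : v \in K -> polar K \subset star v.
Proof. by move=> vK; rewrite -polar1 polarS ?sub1set. Qed.

Lemma polarU K L : polar (K :|: L) = polar K :&: polar L.
Proof. by apply/setP => u; rewrite !inE subUset. Qed.

Lemma polar_joined K L : L \subset polar K -> joined K L.
Proof.
move=> /subsetP LK u v uK /LK/polarP/(_ _ uK).
by rewrite mem_star => /orP[/eqP|]; [left | rewrite adj_sym; right].
Qed.

Lemma joined_polar K L : joined K L -> L \subset polar K.
Proof.
move=> KL; apply/subsetP => v vL; apply/polarP => u uK; rewrite mem_star.
by case: (KL u v uK vL) => [->|]; rewrite ?eqxx // adj_sym => ->; rewrite orbT.
Qed.

(** Equivalent to [weak]: some member [w] of a weakness family has [v] outside its star, since [v]
    is not in [link v]; conversely [v] and [w] together form such a family. *)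
Definition weakv v := [exists w, (w \notin star v) && (link v \subset star w)].

Definition essential K :=
  (polar (polar K) == K) && [forall v in K :&: polar K, ~~ weakv v].

Lemma essentialP K : reflect
  (polar (polar K) = K /\ forall v, v \in K -> v \in polar K -> ~~ weakv v)
  (essential K).
Proof.
apply: (iffP andP) => -[]; first move=> /eqP -> /forall_inP H.
  by split=> // v vK vp; apply: H; rewrite inE vK.
by move=> -> H; rewrite eqxx; split=> //; apply/forall_inP => v /setIP[]; apply: H.
Qed.

Definition common_link U := [set u | [forall k in U, adj k u]].

Lemma common_linkP U u : reflect (forall k, k \in U -> adj k u) (u \in common_link U).
Proof. by rewrite inE; apply: forall_inP. Qed.

Lemma joined_common_link U : joined U (common_link U).
Proof. by move=> u v uU /common_linkP/(_ _ uU); right. Qed.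

Lemma disjoint_common_link U : [disjoint U & common_link U].
Proof.
rewrite -setI_eq0 -subset0; apply/subsetP => u /setIP[uU /common_linkP/(_ _ uU)].
by rewrite adj_irr.
Qed.

Lemma common_linkS U T : U \subset T -> common_link T \subset common_link U.
Proof.
by move=> /subsetP UT; apply/subsetP => u /common_linkP h; apply/common_linkP => k /UT/h.
Qed.

Lemma common_link1 v : common_link [set v] = link v.
Proof.
apply/setP => u; rewrite [RHS]inE; apply/common_linkP/idP => [|vu k /set1P->//].
by apply; rewrite set11.
Qed.

Lemma star_common_link v : [set v] :|: common_link [set v] = star v.
Proof. by rewrite common_link1. Qed.

(** Connectedness of the complement graph on [U]: no splitting of [U] as a join of two nonempty
    parts. *)
Definition coconnected U := forall T, T \subset U -> T != set0 ->
  (forall t u, t \in T -> u \in U -> u \notin T -> adj t u) -> T = U.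

Lemma coconnected1 v : coconnected [set v].
Proof. by move=> T; rewrite subset1 => /orP[/eqP//|/eqP->]; rewrite eqxx. Qed.
End Polar.

(** * Centralizers *)

Section Centralizer.
Variable G : graph.
Implicit Types (K L S T U M : {set G}) (x y z g h k l t : raag G) (u v w : G).

Lemma rho_disjoint K L x : inA L x -> [disjoint K & L] -> rho K x = 1.
Proof.
by move=> Lx /disjoint_setI0 KL; apply: inA0; rewrite -KL inA_rhoI.
Qed.

Lemma csupp_rho K x : csupp (rho K x) \subset K :&: csupp x.
Proof.
have [g cg] := csupp_conj x.
by rewrite -cin_csupp -(cinJ _ _ (rho K g)) -rhoJ inA_cin ?inA_rhoI.
Qed.

(** If [h] involves [v] outside [S], then [commute_cin_link] conjugates [x] into the link of [v]; as
    [x] has conjugacy support [S], all of [S] is adjacent to [v]. *)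
Lemma commute_inA S x h : inA S x -> csupp x = S -> commute h x ->
  inA (S :|: common_link S) h.
Proof.
move=> Sx cx hx; rewrite inA_supp; apply/subsetP => v vh; rewrite inE.
case: (boolP (v \in S)) => //= vS; apply/common_linkP => k kS.
have Bx : inA (~: [set v]) x.
  by apply: inAS Sx; apply/subsetP => u uS; rewrite !inE; apply: contraNneq vS => <-.
have : cin (link v) x.
  apply: commute_cin_link Bx hx _; rewrite inA_supp.
  by apply/negP => /subsetP/(_ v vh); rewrite !inE eqxx.
by rewrite cin_csupp cx => /subsetP/(_ _ kS); rewrite inE adj_sym.
Qed.

Lemma commute_gen v h : commute h (gen v) <-> inA (star v) h.
Proof.
split=> [hv|sh].
  by rewrite -star_common_link; apply: commute_inA hv; rewrite ?csupp_gen ?inA_gen ?set11.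
apply: (commute_joined (K := star v) (L := [set v])); rewrite ?inA_gen ?set11 //.
by apply/joined_sym/polar_joined; rewrite polar1.
Qed.

(** Here [h] lies in the direct product of the subgroups of [T] and [R]. Its first component
    commutes with [rho T z] by retraction, its second with the whole subgroup of [T]. *)
Lemma commute_join T T' z h : joined T T' -> [disjoint T & T'] ->
  inA (T :|: T') z -> csupp z = T :|: T' -> commute h z -> commute h (rho T z).
Proof.
move=> jT dT Uz cz hz; set U := T :|: T' in Uz cz.
pose R := T' :|: common_link U.
have jR : joined T R.
  move=> u v uT; rewrite inE => /orP[|/(joined_common_link (u := u))]; first exact: jT.
  by apply; rewrite inE uT.
have dR : [disjoint T & R].
  rewrite disjoint_sym.
  have := disjoint_common_link U; rewrite -!setI_eq0 => /eqP dU.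
  rewrite setIUl setU_eq0 [T' :&: T]setIC setI_eq0 dT /= -subset0 -dU setIC setISS //.
  exact: subsetUl.
have : inA (T :|: R) h by rewrite setUA; apply: commute_inA hz.
move=> /inAP <-; rewrite rhoU //; apply: commuteMl.
  by rewrite /commute -!rhoM hz.
exact/commute_sym/(commute_joined jR)/inA_rho/inA_rho.
Qed.

(** A vertex [u] missing from [csupp k] is adjacent to all of [csupp k], again by
    [commute_cin_link]; coconnectedness then leaves no room for such a [u]. *)
Lemma coconnected_csupp U z k : coconnected U -> inA U z -> csupp z = U ->
  inA U k -> commute k z -> k != 1 -> csupp k = U.
Proof.
move=> cU Uz cz Uk kz k1; apply: cU; first exact: csupp_inA.
  by apply: contraNneq k1 => /csupp_eq0 ->.
move=> t u tk uU uk; have [g ck] := csupp_conj k.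
have Bk : inA (~: [set u]) (k ^ g).
  by apply: inAS ck; apply/subsetP => w wk; rewrite !inE; apply: contraNneq uk => <-.
have : cin (link u) (k ^ g).
  apply: commute_cin_link Bk (commuteJ g (commute_sym kz)) _.
  apply/negP => /csupp_inA; rewrite csuppJ cz => /subsetP/(_ u uU).
  by rewrite !inE eqxx.
by rewrite cinJ cin_csupp => /subsetP/(_ t tk); rewrite inE adj_sym.
Qed.

Definition cyclic_by U z g := forall k, inA U k -> commute k z ->
  exists n, k = g ^+ n \/ k = g ^- n.

(** For [v] in [U], a nontrivial element of this centralizer has full support, so it is not
    conjugate into the complement of [v]; thus [cyclic_of_cin] applies. *)
Lemma coconnected_cyclic U z : coconnected U -> inA U z -> csupp z = U -> z != 1 ->
  exists g, [/\ inA U g, commute g z & cyclic_by U z g].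
Proof.
move=> cU Uz cz z1.
have [v vU] : exists v, v \in U.
  by apply/set0Pn; rewrite -cz; apply: contraNneq z1 => /csupp_eq0 ->.
have [|||||g [Ug gz] H] := @cyclic_of_cin G v (fun k => inA U k /\ commute k z) z _ _ _ _ _ z1.
- by move=> y k [Uy yz] [Uk kz]; split; [apply: inAM | apply: commuteMl].
- by move=> y [Uy yz]; split; [apply: inAV | apply: commuteVl].
- by split.
- by move=> y [].
- move=> y [Uy yz]; rewrite cin_csupp => sy; apply/eqP; apply: contraT => y1.
  move: sy; rewrite (coconnected_csupp cU Uz cz Uy yz y1) => /subsetP/(_ v vU).
  by rewrite !inE eqxx.
- by exists g; split=> // k Uk kz; apply: H.
Qed.

Lemma commute_powers g k l n m :
  k = g ^+ n \/ k = g ^- n -> l = g ^+ m \/ l = g ^- m -> commute k l.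
Proof.
have h : commute (g ^+ n) (g ^+ m) by apply: commuteX2.
by do 2![case=> ->]; do ?[apply: commuteVl | apply: commuteV].
Qed.

(** Both [z] and the [U]-part of [h] are powers of a generator of the centralizer of [k] in the
    subgroup of [U]; the rest of [h] commutes with that subgroup. *)
Lemma commute_coconnected U z k h : coconnected U -> inA U z -> csupp z = U ->
  inA U k -> commute k z -> k != 1 -> commute h k -> commute h z.
Proof.
move=> cU Uz cz Uk kz k1 hk.
have ck := coconnected_csupp cU Uz cz Uk kz k1.
have := commute_inA Uk ck hk => /inAP <-.
rewrite rhoU; [|exact: joined_common_link|exact: disjoint_common_link].
apply: commuteMl; last first.
  exact/commute_sym/(commute_joined (@joined_common_link _ U) Uz)/inA_rho.
have [g [_ _ gP]] := coconnected_cyclic cU Uk ck k1.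
have [|n hn] := gP (rho U h) (inA_rho _ _).
  by rewrite -[k in commute _ k](inAP _ _ Uk) /commute -!rhoM hk.
have [m zm] := gP z Uz (commute_sym kz).
exact: commute_powers hn zm.
Qed.

Lemma commute_coconnectedM U z k l h : coconnected U -> inA U z -> csupp z = U ->
  inA U k -> commute k z -> k != 1 -> inA (common_link U) l ->
  commute h (k * l) -> commute h z.
Proof.
move=> cU Uz cz Uk kz k1 Ll hkl; set L := common_link U in Ll.
have jUL : joined U L := @joined_common_link _ U.
have dUL : [disjoint U & L] := disjoint_common_link U.
have ck := coconnected_csupp cU Uz cz Uk kz k1.
have [b Lb lb] := csupp_conj_in Ll.
have sl := csupp_inA Ll.
(* Conjugation by [b] cyclically reduces [l] and fixes [k] and [z]; then [t] has full support in
   [M], and its centralizer can be bounded. *)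
pose t := k * l ^ b; pose M := U :|: csupp l.
have tE : (k * l) ^ b = t.
  by rewrite conjMg [k ^ b]commute_conj //; apply: commute_joined jUL Uk Lb.
have Llb : inA L (l ^ b) := inAS sl lb.
have rUt : rho U t = k by rewrite rhoM (inAP _ _ Uk) (rho_disjoint Llb) ?mulg1.
have rLt : rho L t = l ^ b.
  by rewrite rhoM (inAP _ _ Llb) (rho_disjoint Uk) ?mul1g // disjoint_sym.
have Mt : inA M t by apply: inAM; [apply: inAS Uk; apply: subsetUl | apply: inAS lb; apply: subsetUr].
have ct : csupp t = M.
  apply/eqP; rewrite eqEsubset csupp_inA //= subUset -{1}ck -rUt -(csuppJ l b) -rLt.
  by rewrite !(subset_trans (csupp_rho _ _)) ?subsetIr.
have hb : commute (h ^ b) t by rewrite -tE; apply: commuteJ.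
have : inA (U :|: L) (h ^ b).
  apply: inAS (commute_inA Mt ct hb); rewrite !subUset subsetUl (subset_trans sl) ?subsetUr //=.
  by rewrite (subset_trans (common_linkS (subsetUl _ _))) ?subsetUr.
move=> ULh; have zb : z ^ b = z by apply: commute_conj; apply: commute_joined jUL Uz Lb.
suff: commute (h ^ b) z by move/(commuteJ b^-1); rewrite conjgK -{1}zb conjgK.
apply: (commute_coconnected cU Uz cz Uk kz k1).
rewrite -(inAP _ _ ULh) rhoU //; apply: commuteMl.
  by rewrite -rUt /commute -!rhoM hb.
exact/commute_sym/(commute_joined jUL Uk)/inA_rho.
Qed.

Lemma clique_inA_csupp M t : joined M M -> inA M t -> inA (csupp t) t.
Proof.
move=> jM Mt; have [a Ma] := csupp_conj_in Mt.
by rewrite commute_conj //; apply: commute_joined jM Mt Ma.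
Qed.

Lemma clique_centralizer M t h : joined M M -> inA M t ->
  commute h t <-> inA (polar (csupp t)) h.
Proof.
move=> jM Mt; have ct := clique_inA_csupp jM Mt; split=> [ht|ph]; last first.
  by apply/commute_sym/(commute_joined _ ct ph)/polar_joined.
apply: inAS (commute_inA ct _ ht) => //; rewrite subUset !joined_polar //.
  exact: joined_common_link.
by apply: joinedS jM; apply: csupp_inA.
Qed.

Lemma inA_polar K h : (forall u, u \in K -> commute h (gen u)) <-> inA (polar K) h.
Proof.
split=> [hK|ph u uK]; last by apply/commute_gen; apply: inAS ph; apply: sub_polar_star.
rewrite inA_supp; apply/subsetP => w wh; apply/polarP => u /hK/commute_gen.
by rewrite inA_supp mem_starC => /subsetP/(_ w wh).
Qed.
End Centralizer.

(** * Elements that behave like weak vertices *)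

Section Bad.
Variable T : groupType.
Implicit Types x y z q h t g : T.

Definition CC x z := exists g, commute (x ^ g) z.

(** Membership in the center of the centralizer of [z]. *)
Definition ZC z q := forall h, commute h z -> commute h q.

(* The centralizer of [z] is, modulo squares, generated by [z] and its
   intersection with the centralizer of [y], and the central elements which do
   not commute with [y] have the same centralizer as [z]. *)
Definition bad z := exists y, [/\ ~ commute z y,
  forall h, commute h z -> exists q, ZC z q /\
    (commute (h * (q * q)) y \/ commute (h * z * (q * q)) y)
  & forall t, ZC z t -> commute t y \/ (forall h, commute h t -> commute h z)].

Definition perp (I : finType) (A : {set I}) (x : I -> T) z :=
  forall i, i \in A -> CC (x i) z.

Lemma CCJ x z g : CC (x ^ g) z <-> CC x z.
Proof.
split=> -[h]; first by rewrite -conjgM => H; exists (g * h).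
by move=> H; exists (g^-1 * h); rewrite conjgM conjgK.
Qed.

Lemma CC_sym x z : CC x z -> CC z x.
Proof. by case=> g /commute_conjC/commute_sym H; exists g^-1. Qed.

Lemma CCJr x z g : CC x (z ^ g) <-> CC x z.
Proof. by split=> /CC_sym h; apply/CC_sym; move: h => /CCJ. Qed.

Lemma ZCJ z q g : ZC z q -> ZC (z ^ g) (q ^ g).
Proof.
move=> zq h /(commuteJ g^-1); rewrite conjgK => /zq/(commuteJ g).
by rewrite conjgKV.
Qed.

Lemma badJ z g : bad z -> bad (z ^ g).
Proof.
case=> y [nzy H1 H2]; exists (y ^ g); split.
- by move/(commuteJ g^-1); rewrite !conjgK.
- move=> h /(commuteJ g^-1); rewrite conjgK => /H1[q [zq hq]].
  exists (q ^ g); split; first exact: ZCJ.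
  rewrite -!(conjMg q q) -{1 2}[h](conjgKV g) -!conjMg.
  by case: hq => /(commuteJ g); [left | right].
- move=> t /(@ZCJ _ _ g^-1); rewrite conjgK => /H2[H|H]; [left | right].
    by move: H => /(commuteJ g); rewrite conjgKV.
  by move=> h /(commuteJ g^-1)/H/(commuteJ g); rewrite conjgKV.
Qed.
End Bad.

Section BadElements.
Variable G : graph.
Implicit Types (K L S U M Q : {set G}) (x y z g h k l t q : raag G) (u v w : G).

Lemma CC_joined x z : joined (csupp x) (csupp z) -> CC x z.
Proof.
have [a xa] := csupp_conj x; have [b zb] := csupp_conj z.
by move=> j; apply/(CCJ _ _ a)/(CCJr _ _ b); exists 1; rewrite conjg1; apply: commute_joined xa zb.
Qed.

Lemma CC_gen v z : CC (gen v) z <-> csupp z \subset star v.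
Proof.
split=> [|sz]; last first.
  by apply: CC_joined; apply: polar_joined; rewrite csupp_gen polar1.
case=> g /commute_conjC/commute_sym/commute_gen/csupp_inA.
by rewrite csuppJ.
Qed.

Lemma cyclic_half g k n : k = g ^+ n \/ k = g ^- n -> exists q m,
  (q = g ^+ m \/ q = g ^- m) /\ (k * (q * q) = 1 \/ k * g * (q * q) = 1).
Proof.
have sq m : g ^+ m * g ^+ m = g ^+ m.*2 by rewrite -expgnDr addnn.
have sqV m : g ^- m * g ^- m = g ^- m.*2 by rewrite -invgM sq.
have := odd_double_half n; case: (odd n) => /= en [] ->.
- exists (g ^- n./2.+1), n./2.+1; split; first by right.
  by right; rewrite sqV -expgSr -{1}en doubleS mulgV.
- exists (g ^+ n./2), n./2; split; first by left.
  right; rewrite sq -[n in g ^- n]en add1n expgSr invgM.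
  rewrite (_ : g^-1 * g ^- n./2.*2 = g ^- n./2.*2 * g^-1) ?mulgVK ?mulVg //.
  by apply: commuteV; apply: commuteVl; apply: commuteX; apply: commute_refl.
- exists (g ^- n./2), n./2; split; first by right.
  by left; rewrite sqV -{1}en add0n mulgV.
- exists (g ^+ n./2), n./2; split; first by left.
  by left; rewrite sq -[n in g ^- n]en add0n mulVg.
Qed.

(** The centralizer of [g] is the product of a cyclic group and the subgroup of [common_link U], and
    the latter commutes with [gen w]. So [gen w] is a witness: the cyclic part has at most two
    classes modulo squares, and a central element with nontrivial [U]-part has no larger centralizer
    than [g]. *)
Lemma bad_cyclic U g w : coconnected U -> inA U g -> csupp g = U -> cyclic_by U g g ->
  common_link U \subset star w -> ~ commute g (gen w) -> bad g.
Proof.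
move=> cU Ug cg gP Lw ngw; set L := common_link U in Lw.
have jUL : joined U L := @joined_common_link _ U.
have dec h : commute h g -> [/\ h = rho L h * rho U h, commute (rho L h) (gen w),
    inA L (rho L h), inA U (rho U h) & commute (rho U h) g].
  move=> hg; have /inAP := commute_inA Ug cg hg.
  rewrite rhoU ?disjoint_common_link //; have jc := commute_joined jUL (inA_rho U h) (inA_rho L h).
  rewrite jc => e; split; rewrite ?inA_rho //; first exact/commute_gen/(inAS Lw)/inA_rho.
  by rewrite -[g in commute _ g](inAP _ _ Ug) /commute -!rhoM hg.
exists (gen w); split=> //.
- move=> h hg; have [eh lw Ll Uk kg] := dec h hg.
  have [n kn] := gP _ Uk kg; have [q [m [qm hq]]] := cyclic_half kn.
  exists q; split.
    by move=> h' h'g; case: qm => ->; do ?apply: commuteV; apply: commuteX.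
  move: (rho L h) (rho U h) eh lw hq {Ll Uk kg kn} => l k -> lw hq.
  case: hq => hq; [left | right]; first by rewrite -mulgA hq mulg1.
  by rewrite -(mulgA l k g) -mulgA hq mulg1.
move=> t zt; have gt : commute t g by apply/commute_sym/zt.
have [et lw Ll Uk kg] := dec t gt.
have [k1|k1] := eqVneq (rho U t) 1; first by left; rewrite et k1 mulg1.
right=> h ht; apply: (commute_coconnectedM cU Ug cg Uk kg k1 Ll).
by rewrite (commute_joined jUL Uk Ll) -et.
Qed.

Lemma inA1_powers v k : inA [set v] k -> exists n, k = gen v ^+ n \/ k = gen v ^- n.
Proof.
elim/inA_wind => [|[u b] {}k /set1P /= -> [n IH]]; first by exists 0; left; rewrite expg0.
rewrite lgenE; case: b IH => -[->|->].
- by exists n.+1; left; rewrite expgS.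
- case: n => [|n]; first by exists 1%N; left; rewrite expg0 invg1 mulg1.
  by exists n; right; rewrite expgSr invgM mulVKg.
- case: n => [|n]; first by exists 1%N; right; rewrite expg0 mulg1.
  by exists n; left; rewrite expgS mulKg.
- by exists n.+1; right; rewrite expgSr invgM.
Qed.

Lemma bad_weakv v : weakv v -> bad (gen v).
Proof.
case/existsP=> w /andP[vw lv]; apply: (@bad_cyclic [set v] _ w).
- exact: coconnected1.
- by rewrite inA_gen ?set11.
- exact: csupp_gen.
- by move=> k /inA1_powers.
- by rewrite common_link1.
move=> /commute_gen /csupp_inA; rewrite csupp_gen sub1set => vw'.
by move: vw; rewrite mem_starC vw'.
Qed.

(** After conjugation the centralizer of [z] is the subgroup of [polar Q'], and its center is the
    free abelian subgroup of the clique [M]. A witness [y] of badness would isolate one vertex [q0]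
    of [Q'] and make it weak. *)
Lemma strong_clique_not_bad Q z : joined Q Q -> (forall v, v \in Q -> ~~ weakv v) ->
  csupp z \subset Q -> ~ bad z.
Proof.
move=> jQ strongQ sz; have [a za] := csupp_conj z.
move=> /(badJ a); rewrite -(csuppJ z a) in sz za; move: (z ^ a) sz za => {a}z sz Qz.
set Q' := csupp z in sz Qz; pose M := polar (polar Q').
have jQ' : joined Q' Q' := joinedS sz sz jQ.
have jPM : joined (polar Q') M by apply: polar_joined.
have MP : M \subset polar Q' by apply: polarS; apply: joined_polar.
have QM : Q' \subset M := sub_bipolar Q'.
have jM : joined M M := joinedS MP (subxx _) jPM.
have Cz h : commute h z <-> inA (polar Q') h := clique_centralizer h jQ' Qz.
have ZCM t : ZC z t -> inA M t.
  by move=> zt; apply/inA_polar => u uP; apply/commute_sym/zt/Cz/inA_gen.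
have MZC t : inA M t -> ZC z t.
  by move=> Mt h /Cz Ph; apply: commute_joined jPM Ph Mt.
case=> y [nzy H1 H2].
have [q0 q0Q nq0] : exists2 q0, q0 \in Q' & ~ commute (gen q0) y.
  apply: contrapT => nex; apply/nzy/commute_sym/Cz/inA_polar => u uQ.
  by apply: contrapT => nu; apply: nex; exists u => // /commute_sym.
have yC M' t u : joined M' M' -> inA M' t -> commute t y -> u \in csupp t -> commute (gen u) y.
  move=> jM' M't /commute_sym/(clique_centralizer _ jM' M't)/inA_polar h /h.
  exact: commute_sym.
have par0 t u : inA M t -> commute t y -> ~ commute (gen u) y -> parity u t = false.
  move=> Mt ty nu; apply: (parity_notin (clique_inA_csupp jM Mt)).
  by apply/negP => /(yC _ _ _ jM Mt ty)/nu.
have Mz : inA M z := inAS QM Qz.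
have genC u : u \in polar Q' -> commute (gen u) z by move=> uP; apply/Cz/inA_gen.
(* Only [q0] in [M] fails to commute with [y]. For a second such [u], the squares condition at [q0]
   makes the exponent of [u] in [z] even, and then the condition at [u] fails by parity. *)
have par_q0 u : u \in M -> u != q0 -> commute (gen u) y.
  move=> uM uq0; apply: contrapT => nu.
  have q0M : q0 \in M := subsetP QM _ q0Q.
  have parsq w r : parity w (r * r) = false by rewrite parityM addbb.
  have [q [/ZCM Mq hq]] := H1 _ (genC _ (subsetP MP _ q0M)).
  have [r [/ZCM Mr hr]] := H1 _ (genC _ (subsetP MP _ uM)).
  have Mgq : inA M (gen q0) := inA_gen q0M.
  have Mgu : inA M (gen u) := inA_gen uM.
  have Mqq := inAM Mq Mq; have Mrr := inAM Mr Mr.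
  have pz : parity u z = false.
    case: hq => hq.
      have := par0 _ q0 (inAM Mgq Mqq) hq nq0.
      by rewrite parityM parity_gen parsq eqxx.
    have := par0 _ u (inAM (inAM Mgq Mz) Mqq) hq nu.
    by rewrite !parityM parity_gen addbb addbF eq_sym (negPf uq0).
  case: hr => hr.
    have := par0 _ u (inAM Mgu Mrr) hr nu.
    by rewrite parityM parity_gen parsq eqxx.
  have := par0 _ u (inAM (inAM Mgu Mz) Mrr) hr nu.
  by rewrite !parityM parity_gen addbb addbF pz eqxx.
have q0M : q0 \in M := subsetP QM _ q0Q.
have [//|starP] := H2 _ (MZC _ (inA_gen q0M)).
have starQ u : u \in star q0 -> u \in polar Q'.
  move=> us; have : inA (polar Q') (gen u).
    by apply/Cz/starP/commute_gen/inA_gen.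
  by move/csupp_inA; rewrite csupp_gen sub1set.
(* A vertex of the link outside [M] occurs with odd exponent in [gen u] times an element of [M], so
   it is in the support of an element commuting with [y]. *)
have linkC u : u \in link q0 -> commute (gen u) y.
  move=> ul; have uP : u \in polar Q' by apply: starQ; rewrite (subsetP (link_star _)).
  have [uM|uM] := boolP (u \in M).
    by apply: par_q0 => //; apply: contraTneq ul => ->; rewrite notin_link.
  have [q [/ZCM Mq hq]] := H1 _ (genC _ uP).
  have jM' : joined (u |: M) (u |: M).
    move=> a b /setU1P[->|aM] /setU1P[->|bM]; [by left | exact: jPM | | exact: jM].
    exact: (joined_sym jPM).
  have Mu m : inA M m -> inA (u |: M) (gen u * m).
    by move=> Mm; apply: inAM; [apply: inA_gen; rewrite setU11 | apply: inAS Mm; apply: subsetUr].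
  have uu m : inA M m -> u \in csupp (gen u * m).
    move=> Mm; apply: contraT => un.
    have := parity_notin (clique_inA_csupp jM' (Mu _ Mm)) un.
    by rewrite parityM parity_gen eqxx (parity_notin Mm uM).
  case: hq; last rewrite -mulgA; move=> hq.
    by apply: (yC _ _ _ jM' (Mu _ _) hq (uu _ _)); apply: inAM.
  by apply: (yC _ _ _ jM' (Mu _ _) hq (uu _ _)); do ?apply: inAM.
(* All of [link q0] commutes with [y] but [q0] does not: some [w] in the support of [y] shows that
   [q0] is weak. *)
have [w wy nw] : exists2 w, w \in supp y & w \notin star q0.
  apply/subsetPn; rewrite -inA_supp; apply/negP => /commute_gen/commute_sym.
  exact: nq0.
have := strongQ q0 (subsetP sz _ q0Q); case/negP; apply/existsP; exists w.
rewrite nw; apply/subsetP => u /linkC/commute_sym/commute_gen.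
by rewrite inA_supp mem_starC => /subsetP/(_ w wy).
Qed.
End BadElements.

(** * Essential polars *)

Section Perp.
Variables (G : graph) (I : finType) (A : {set I}) (x : I -> raag G).
Implicit Types (T U : {set G}) (z g h : raag G) (u v w : G).

Notation N := (perp A x).
Let J := polar (\bigcup_(i in A) csupp (x i)).

Lemma perpJ z g : N (z ^ g) <-> N z.
Proof. by split=> H i /H /CCJr. Qed.

Lemma perp_sub z h : (forall t, commute t z -> commute t h) -> N z -> N h.
Proof. by move=> zh zN i /zN [g /zh]; exists g. Qed.

Lemma csuppM_joined T T' (a b : raag G) : joined T T' -> inA T a -> inA T' b ->
  csupp (a * b) \subset csupp a :|: csupp b.
Proof.
move=> jT Ta Tb; have [c Tc ca] := csupp_conj_in Ta; have [d Td db] := csupp_conj_in Tb.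
rewrite -(csuppJ _ (c * d)) conjMg !conjgM csupp_inA //.
rewrite [(a ^ c) ^ d]commute_conj; last exact: commute_joined jT (inAJ Ta Tc) Td.
rewrite [b ^ c]commute_conj; last exact/commute_sym/(commute_joined jT).
by apply: inAM; [apply: inAS ca; apply: subsetUl | apply: inAS db; apply: subsetUr].
Qed.

Lemma sub_perp z : csupp z \subset J -> N z.
Proof.
move=> zJ i iA; apply/CC_joined/polar_joined/(subset_trans zJ)/polarS.
exact: (bigcup_sup i).
Qed.

Hypothesis not_bad : forall z, N z -> (forall z', N z' -> CC z z') -> ~ bad z.

(** If [csupp z] is not inside [J], then by the induction hypothesis it is not a join, so the root
    [g] of [z] has a cyclic centralizer in its support. Such a [g] turns out to be a bad element
    excluded by [not_bad]. *)
Lemma perp_sub_aux z : N z -> inA (csupp z) z ->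
  (forall T, T \proper csupp z -> N (rho T z) -> csupp (rho T z) \subset J) ->
  csupp z \subset J.
Proof.
set U := csupp z => zN Uz IH; apply: contraT => nUJ.
have cU : coconnected U.
  move=> T TU T0 jT; apply/eqP; apply: contraT => nTU; case/negP: nUJ.
  have prT : T \proper U by rewrite properEneq nTU.
  have prD : U :\: T \proper U.
    rewrite properEneq subsetDl andbT; case/set0Pn: T0 => t tT.
    by apply: contraTneq (subsetP TU _ tT) => <-; rewrite inE tT.
  have jD : joined T (U :\: T).
    by move=> t u tT /setDP[uU uT]; right; apply: jT.
  have dD : [disjoint T & U :\: T].
    by rewrite -setI_eq0 setIDA setD_eq0 subsetIl.
  have eU : T :|: U :\: T = U by rewrite setDE setUIr setUCr setIT; apply/setUidPr.
  have ez : z = rho T z * rho (U :\: T) z by rewrite -rhoU // eU (inAP _ _ Uz).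
  have NT : N (rho T z).
    by apply: perp_sub zN => t; apply: (commute_join jD dD); rewrite eU.
  have ND : N (rho (U :\: T) z).
    apply: perp_sub zN => t; apply: (commute_join (joined_sym jD)); rewrite 1?setUC ?eU //.
    by rewrite disjoint_sym.
  rewrite /U {1}ez (subset_trans (csuppM_joined jD (inA_rho _ _) (inA_rho _ _))) //.
  by rewrite subUset !IH.
have z1 : z != 1 by apply: contraNneq nUJ => z1; rewrite /U z1 csupp1 sub0set.
have [g [Ug gz gP]] := coconnected_cyclic cU Uz erefl z1.
have g1 : g != 1.
  by apply: contraNneq z1 => g1; have [n [] ->] := gP z Uz (commute_refl z);
     rewrite g1 expg1n ?invg1.
have cg : csupp g = U := coconnected_csupp cU Uz erefl Ug gz g1.
have Czg h : commute h z -> commute h g.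
  exact: (commute_coconnected cU Ug cg Uz (commute_sym gz) z1).
have gN : N g := perp_sub Czg zN.
have gcyc : cyclic_by U g g.
  move=> k Uk kg; apply: gP => //.
  exact: (commute_coconnected cU Uz erefl Ug gz g1).
move: nUJ => /subsetPn[u uU].
have [uJ|/polarP nuJ] := boolP (u \in J) => // _; exfalso.
have [i iA sxi] : exists2 i, i \in A & ~~ (csupp (x i) \subset star u).
  apply: contrapT => nex; apply: nuJ => k /bigcupP[i iA ki]; apply: contrapT => /negP nk.
  by apply: nex; exists i => //; apply/subsetPn; exists k.
have [a xag] := gN i iA; set y := x i ^ a in xag.
have cy : csupp y = csupp (x i) by rewrite csuppJ.
have LJ : common_link U \subset star u.
  by apply/subsetP => w /common_linkP/(_ _ uU); rewrite mem_star => ->; rewrite orbT.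
have /inAP := commute_inA Ug cg xag.
rewrite rhoU; [|exact: joined_common_link|exact: disjoint_common_link].
set k := rho U y; set l := rho _ y => ey.
have Ll : inA (common_link U) l by rewrite inA_rho.
have Uk : inA U k by rewrite inA_rho.
have kg : commute k g by rewrite -[g](inAP _ _ Ug) /commute -!rhoM xag.
(* Otherwise the conjugate [y] of [x i] would lie in the subgroup of [common_link U], hence of
   [star u], against the choice of [i]. *)
have k1 : k != 1.
  apply: contraNneq sxi => k1; rewrite -cy -ey k1 mul1g.
  by rewrite (subset_trans _ LJ) ?csupp_inA.
(* Since [k] is a nontrivial element commuting with [g], whatever commutes with [k * l] commutes
   with [g]; this makes [g] orthogonal to all of [N]. *)
have gN' z' : N z' -> CC g z'.
  move=> /(_ i iA)/(CCJ _ _ a)/CC_sym[b]; rewrite -/y -ey => hb.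
  by apply: CC_sym; exists b; apply: (commute_coconnectedM cU Ug cg Uk kg k1 Ll).
apply: (not_bad gN gN'); apply: (bad_cyclic cU Ug cg gcyc LJ).
(* If [g] commuted with [gen u], coconnectedness would reduce [U] to [u] alone, and [y] would again
   lie in the subgroup of [star u]. *)
move=> /commute_gen /csupp_inA; rewrite cg => Us.
have eU : [set u] = U.
  apply: cU; rewrite ?sub1set //; first by apply/set0Pn; exists u; rewrite set11.
  move=> t w /set1P-> wU; rewrite inE => wu.
  by have := subsetP Us w wU; rewrite mem_star (negPf wu).
case/negP: sxi; rewrite -cy csupp_inA // -star_common_link eU.
exact: commute_inA xag.
Qed.

Lemma perpE z : N z <-> csupp z \subset J.
Proof.
split; last exact: sub_perp.
have [n] := ubnP #|csupp z|; elim: n z => // n IH z ltn zN.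
have [a za] := csupp_conj z; rewrite -(csuppJ z a) in za ltn *.
apply: perp_sub_aux => //; first exact/perpJ.
move=> T prT; apply: IH; have sT := subset_trans (csupp_rho T (z ^ a)) (subsetIl _ _).
by rewrite (leq_ltn_trans (subset_leq_card sT)) // (leq_trans (proper_card prT)).
Qed.

Lemma perp_essential : essential J.
Proof.
apply/essentialP; split; first exact: polar3.
move=> v vJ vP; apply/negP => wv; apply: (not_bad (z := gen v)) (bad_weakv wv).
  by apply/perpE; rewrite csupp_gen sub1set.
move=> z' /perpE sz; apply/CC_gen/(subset_trans sz).
by move: vP; rewrite inE.
Qed.
End Perp.

(** * First-order definability *)

Fixpoint term_rename n m (s : 'I_n -> 'I_m) (t : term n) : term m :=
  match t with
  | Var i => Var (s i)
  | One => One m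
  | Mul t1 t2 => Mul (term_rename s t1) (term_rename s t2)
  | Inv t1 => Inv (term_rename s t1)
  end.

Definition rename_up n m (s : 'I_n -> 'I_m) : 'I_n.+1 -> 'I_m.+1 :=
  fun i => if unlift ord0 i is Some j then lift ord0 (s j) else ord0.

Fixpoint rename n (f : formula n) : forall m, ('I_n -> 'I_m) -> formula m :=
  match f in formula k return forall m, ('I_k -> 'I_m) -> formula m with
  | Eq _ t1 t2 => fun m s => Eq (term_rename s t1) (term_rename s t2)
  | Not _ f1 => fun m s => Not (rename f1 s)
  | And _ f1 f2 => fun m s => And (rename f1 s) (rename f2 s)
  | Or _ f1 f2 => fun m s => Or (rename f1 s) (rename f2 s)
  | Imp _ f1 f2 => fun m s => Imp (rename f1 s) (rename f2 s)
  | Forall _ f1 => fun m s => Forall (rename f1 (rename_up s))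
  | Exists _ f1 => fun m s => Exists (rename f1 (rename_up s))
  end.

Lemma eval_rename (T : groupType) n m (s : 'I_n -> 'I_m) (e : 'I_m -> T) t :
  eval e (term_rename s t) = eval (e \o s) t.
Proof. by elim: t => [i||t1 IH1 t2 IH2|t1 IH1] //=; rewrite IH1 ?IH2. Qed.

Lemma env_cons_up (T : Type) n m (s : 'I_n -> 'I_m) (e : 'I_m -> T) a :
  env_cons a e \o rename_up s = env_cons a (e \o s).
Proof.
apply/funext => i; rewrite /env_cons /rename_up /=.
by case: (unliftP ord0 i) => [j _|_]; rewrite ?liftK ?unlift_none.
Qed.

Lemma holds_rename (T : groupType) n (f : formula n) m (s : 'I_n -> 'I_m) (e : 'I_m -> T) :
  holds (rename f s) e <-> holds f (e \o s).
Proof.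
elim: f m s e => {n} /=.
- by move=> n t1 t2 m s e; rewrite !eval_rename.
- by move=> n f IH m s e; rewrite IH.
- by move=> n f IHf g IHg m s e; rewrite IHf IHg.
- by move=> n f IHf g IHg m s e; rewrite IHf IHg.
- by move=> n f IHf g IHg m s e; rewrite IHf IHg.
- by move=> n f IH m s e; split=> H a; move: (H a); rewrite IH env_cons_up.
- by move=> n f IH m s e; split=> -[a H]; exists a; move: H; rewrite IH env_cons_up.
Qed.

Fixpoint exists_closure n : formula n -> sentence :=
  if n is m.+1 then fun f => exists_closure (Exists f) else id.

Lemma satisfies_closure (T : groupType) n (f : formula n) :
  satisfies T (exists_closure f) <-> exists e : 'I_n -> T, holds f e.
Proof.
elim: n f => [|n IH] f /=.
  split=> [H|[e H] e']; last by rewrite (_ : e' = e) //; apply/funext => -[].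
  by exists (fun=> 1).
rewrite IH /=; split=> [[e [a H]]|[e H]]; first by exists (env_cons a e).
exists (fun i => e (lift ord0 i)), (e ord0).
rewrite (_ : env_cons _ _ = e) //; apply/funext => i; rewrite /env_cons.
by case: unliftP => [j|] ->.
Qed.

Section Definable.
Implicit Type I : finType.

(** One formula must work in all groups at once. Variables are named by a finite type; a quantifier
    passes from [I] to [option I], with [None] the bound variable. *)
Definition definable I (P : forall T : groupType, (I -> T) -> Prop) :=
  exists f : formula #|I|, forall (T : groupType) (e : I -> T),
    holds f (fun i => e (enum_val i)) <-> P T e.

Definition term_definable I (t : forall T : groupType, (I -> T) -> T) :=
  exists t' : term #|I|, forall (T : groupType) (e : I -> T),
    eval (fun i => e (enum_val i)) t' = t T e.

Lemma tdef_var I (i : I) : term_definable (fun T e => e i).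
Proof. by exists (Var (enum_rank i)) => T e /=; rewrite enum_rankK. Qed.

Lemma tdef_mul I t1 t2 : term_definable t1 -> term_definable t2 ->
  @term_definable I (fun T e => t1 T e * t2 T e).
Proof. by move=> [u1 h1] [u2 h2]; exists (Mul u1 u2) => T e /=; rewrite h1 h2. Qed.

Lemma tdef_inv I t : term_definable t -> @term_definable I (fun T e => (t T e)^-1).
Proof. by move=> [u h]; exists (Inv u) => T e /=; rewrite h. Qed.

Lemma tdef_conj I t1 t2 : term_definable t1 -> term_definable t2 ->
  @term_definable I (fun T e => t1 T e ^ t2 T e).
Proof. by move=> h1 h2; apply: tdef_mul (tdef_inv h2) (tdef_mul h1 h2). Qed.

Lemma tdef_weaken I t : @term_definable I t ->
  @term_definable (option I) (fun T e => t T (fun i => e (Some i))).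
Proof.
move=> [u h]; exists (term_rename (fun i => enum_rank (Some (enum_val i))) u) => T e.
rewrite eval_rename -h; congr (eval _ _).
by apply/funext => i; rewrite /= enum_rankK.
Qed.

Lemma def_eq I t1 t2 : term_definable t1 -> term_definable t2 ->
  @definable I (fun T e => t1 T e = t2 T e).
Proof. by move=> [u1 h1] [u2 h2]; exists (Eq u1 u2) => T e /=; rewrite h1 h2. Qed.

Lemma def_not I P : definable P -> @definable I (fun T e => ~ P T e).
Proof. by move=> [f h]; exists (Not f) => T e /=; rewrite h. Qed.

Lemma def_and I P Q : definable P -> definable Q -> @definable I (fun T e => P T e /\ Q T e).
Proof. by move=> [f h] [g k]; exists (And f g) => T e /=; rewrite h k. Qed.

Lemma def_or I P Q : definable P -> definable Q -> @definable I (fun T e => P T e \/ Q T e).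
Proof. by move=> [f h] [g k]; exists (Or f g) => T e /=; rewrite h k. Qed.

Lemma def_imp I P Q : definable P -> definable Q -> @definable I (fun T e => P T e -> Q T e).
Proof. by move=> [f h] [g k]; exists (Imp f g) => T e /=; rewrite h k. Qed.

Lemma def_true I : @definable I (fun _ _ => True).
Proof. by exists (Eq (One _) (One _)). Qed.

Lemma def_ext I P Q : (forall T e, P T e <-> Q T e) -> definable P -> @definable I Q.
Proof. by move=> PQ [f h]; exists f => T e; rewrite h. Qed.

Let bind I (i : 'I_#|{: option I}|) : 'I_#|I|.+1 :=
  if enum_val i is Some j then lift ord0 (enum_rank j) else ord0.

Let bindE I (T : groupType) (e : I -> T) a :
  env_cons a (fun i => e (enum_val i)) \o @bind I =
  (fun i => if enum_val i is Some j then e j else a).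
Proof.
apply/funext => i; rewrite /env_cons /bind /=.
by case: (enum_val i) => [j|]; rewrite ?liftK ?enum_rankK ?unlift_none.
Qed.

Lemma def_ex I (P : forall T : groupType, (I -> T) -> T -> Prop) :
  @definable (option I) (fun T e => P T (fun i => e (Some i)) (e None)) ->
  definable (fun T e => exists a, P T e a).
Proof.
move=> [f h]; exists (Exists (rename f (@bind I))) => T e /=.
have H a := h T (fun o => if o is Some i then e i else a).
by split=> -[a Pa]; exists a; move: Pa; rewrite holds_rename bindE (H a).
Qed.

Lemma def_all I (P : forall T : groupType, (I -> T) -> T -> Prop) :
  @definable (option I) (fun T e => P T (fun i => e (Some i)) (e None)) ->
  definable (fun T e => forall a, P T e a).
Proof.
move=> [f h]; exists (Forall (rename f (@bind I))) => T e /=.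
have H a := h T (fun o => if o is Some i then e i else a).
by split=> Pa a; move: (Pa a); rewrite holds_rename bindE (H a).
Qed.

Lemma def_fin I (J : finType) (b : pred J) P :
  (forall j, b j -> definable (P j)) -> @definable I (fun T e => forall j, b j -> P j T e).
Proof.
move=> defP.
suff [f h] : @definable I (fun T e => forall j, j \in enum J -> b j -> P j T e).
  by exists f => T e; rewrite h; split=> H j; [apply: H; rewrite mem_enum | move=> _; apply: H].
elim: (enum J) => [|j s IH].
  by apply: def_ext (def_true I) => T e; split.
apply: (@def_ext _ (fun T e => (b j -> P j T e) /\ (forall j, j \in s -> b j -> P j T e))).
  move=> T e; split=> [[Pj Ps] k|H].
    by rewrite inE => /orP[/eqP->|/Ps].
  by split=> [|k ks]; apply: H; rewrite inE ?eqxx ?ks ?orbT.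
apply: def_and IH; case: (boolP (b j)) => [bj|nbj].
  by apply: def_ext (defP j bj) => T e; split=> //; apply.
by apply: def_ext (def_true I) => T e; split.
Qed.

Lemma def_satisfies I P : @definable I P ->
  exists f : sentence, forall T, satisfies T f <-> exists e, P T e.
Proof.
move=> [f h]; exists (exists_closure f) => T; rewrite satisfies_closure.
split=> -[e H].
  exists (fun i => e (enum_rank i)); apply/h.
  by rewrite (_ : (fun i => _) = e) //; apply/funext => i; rewrite enum_valK.
by exists (fun i => e (enum_val i)); apply/h.
Qed.

Lemma elementary_equiv_ex (T T' : groupType) I P : elementary_equiv T T' ->
  @definable I P -> (exists e, P T e) -> exists e, P T' e.
Proof. by move=> TT' /def_satisfies[f h] /h/TT'/h. Qed.

Lemma def_commute I t1 t2 : term_definable t1 -> term_definable t2 ->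
  @definable I (fun T e => commute (t1 T e) (t2 T e)).
Proof. by move=> h1 h2; apply: def_eq; apply: tdef_mul. Qed.

Lemma def_CC I t1 t2 : term_definable t1 -> term_definable t2 ->
  @definable I (fun T e => CC (t1 T e) (t2 T e)).
Proof.
move=> h1 h2; apply: def_ex; apply: def_commute (tdef_weaken h2).
exact: tdef_conj (tdef_weaken h1) (tdef_var None).
Qed.

Lemma def_ZC I t1 t2 : term_definable t1 -> term_definable t2 ->
  @definable I (fun T e => ZC (t1 T e) (t2 T e)).
Proof.
move=> h1 h2; apply: def_all; apply: def_imp.
  exact: def_commute (tdef_var None) (tdef_weaken h1).
exact: def_commute (tdef_var None) (tdef_weaken h2).
Qed.

Lemma def_bad I t : term_definable t -> @definable I (fun T e => bad (t T e)).
Proof.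
move=> ht; apply: def_ex.
have hz := tdef_weaken ht; have hy := tdef_var (None : option I).
have hz1 := tdef_weaken hz; have hy1 := tdef_weaken hy.
have hz2 := tdef_weaken hz1; have hy2 := tdef_weaken hy1.
have h1 := tdef_var (None : option (option I)); have h2 := tdef_weaken h1.
have q := tdef_var (None : option (option (option I))); have qq := tdef_mul q q.
set P := (P in definable P); apply: (@def_ext _ (fun T e =>
  ~ commute (t T (fun i => e (Some i))) (e None) /\
  ((forall h, commute h (t T (fun i => e (Some i))) -> exists q, ZC (t T (fun i => e (Some i))) q /\
      (commute (h * (q * q)) (e None) \/
       commute (h * t T (fun i => e (Some i)) * (q * q)) (e None))) /\
   (forall u, ZC (t T (fun i => e (Some i))) u -> commute u (e None) \/
      (forall h, commute h u -> commute h (t T (fun i => e (Some i)))))))).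
  by move=> T e; split=> [[? []]|[]].
apply: def_and; first exact/def_not/def_commute.
apply: def_and; apply: def_all; apply: def_imp.
- exact: def_commute.
- apply: def_ex; apply: def_and; first exact: def_ZC.
  apply: def_or; apply: def_commute => //; apply: tdef_mul => //.
  exact: tdef_mul.
- exact: def_ZC.
apply: def_or; first exact: def_commute.
by apply: def_all; apply: def_imp; apply: def_commute => //; apply: tdef_var.
Qed.
End Definable.

(** * Comparison of essential sets *)

Section SquaresInCliques.
Variable G : graph.
Implicit Types (Q A K : {set G}) (c r x : raag G) (u v q : G).

Lemma parity_rho K u x : parity u (rho K x) = (u \in K) && parity u x.
Proof.
elim/quotW: x => w; rewrite rho_pi !parity_pi /restr.
elim: w => [|l w IH] /=; first by rewrite andbF.
case: ifPn => lK /=; rewrite !oddD IH !oddb.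
  by case: eqP => [<-|_]; rewrite ?lK.
by case: eqP lK => [<- /negPf->|].
Qed.

Lemma parityX u x n : parity u (x ^+ n) = odd n && parity u x.
Proof.
elim: n => [|n IH]; first by rewrite expg0 parity1.
by rewrite expgS parityM IH /=; case: (odd n); case: (parity u x).
Qed.

(** A clique generates a free abelian group, where an element with even exponents is a square;
    vertices are split off one at a time. *)
Lemma clique_square Q c : joined Q Q -> inA Q c -> (forall u, parity u c = false) ->
  exists2 r, inA Q r & c = r * r.
Proof.
have [n] := ubnP #|Q|; elim: n Q c => // n IH Q c leQ jQ Qc pc.
have [Q0|[q qQ]] := set_0Vmem Q.
  by exists 1; rewrite ?inA1 // mulg1; apply: inA0; rewrite -Q0.
pose Q1 := Q :\ q.
have sQ1 : Q1 \subset Q := subD1set _ _.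
have jq : joined [set q] Q1 by apply: joinedS jQ; rewrite ?sub1set.
have dq : [disjoint [set q] & Q1] by rewrite disjoints1 !inE eqxx.
have [||||t Q1t ct] := IH Q1 (rho Q1 c).
- by rewrite -ltnS (leq_trans _ leQ) // ltnS [in X in _ <= X](cardsD1 q) qQ.
- exact: joinedS jQ.
- exact: inA_rho.
- by move=> u; rewrite parity_rho pc andbF.
have [s qs cs] : exists2 s, inA [set q] s & rho [set q] c = s * s.
  have [m h] := inA1_powers (inA_rho [set q] c).
  have om : odd m = false.
    have := parity_rho [set q] q c; rewrite pc andbF.
    by case: h => ->; rewrite ?parityV parityX parity_gen eqxx andbT.
  have em : m = (m./2 + m./2)%N by rewrite addnn -[LHS]odd_double_half om.
  have qg : inA [set q] (gen q) by rewrite inA_gen ?set11.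
  case: h => ->; rewrite {1}em expgnDr ?invgM.
    by exists (gen q ^+ m./2); rewrite ?inAX.
  by exists (gen q ^- m./2); rewrite ?inAV ?inAX.
have cst : commute s t := commute_joined jq qs Q1t.
exists (s * t); first by apply: inAM; [apply: inAS qs; rewrite sub1set | apply: inAS Q1t].
rewrite -(inAP _ _ Qc) -[Q in LHS](setD1K qQ) rhoU // cs ct.
by rewrite !mulgA -[s * t * s]mulgA -cst mulgA.
Qed.

Definition setgen A : raag G := \pi_(raag G) [seq (q, true) | q <- enum A].

Lemma inA_setgen A : inA A (setgen A).
Proof.
rewrite /inA /setgen rho_pi /restr (_ : [seq _ <- _ | _] = [seq (q, true) | q <- enum A]) //.
by apply/all_filterP/allP => l /mapP[q]; rewrite mem_enum => qA ->.
Qed.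

Lemma parity_setgen A u : parity u (setgen A) = (u \in A).
Proof.
rewrite parity_pi count_map (eq_count (a2 := pred1 u)) //.
by rewrite count_uniq_mem ?enum_uniq // mem_enum oddb.
Qed.
End SquaresInCliques.

(** * The first-order pattern of the essential sets *)

Section Pattern.
Variable G : graph.
Implicit Types (K A : {set G}).

Definition center K := K :&: polar K.

Notation I := (G + {set G} * {set G})%type.
Notation N e K := (perp (polar K) (fun v => e (inl v))).

(* The tuple has an entry for each vertex, and for each subset [A] of the
   center of an essential set [K] an entry indexed by [(K, A)], which stands
   for the product of the vertices in [A].  The last two clauses bound the rank
   of the center from below by counting classes modulo squares. *)
Definition pattern (T : groupType) (e : I -> T) : Prop :=
  (forall K, essential K -> forall z, N e K z ->
      (forall z', N e K z' -> CC z z') -> ~ bad z) /\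
  ((forall p : {set G} * {set G}, [&& essential p.1, essential p.2 & p.1 \subset p.2] ->
      forall z, N e p.1 z -> N e p.2 z) /\
  ((forall p : {set G} * {set G}, [&& essential p.1, essential p.2 & ~~ (p.1 \subset p.2)] ->
      ~ forall z, N e p.1 z -> N e p.2 z) /\
  ((forall p : {set G} * {set G}, [&& essential p.1, essential p.2 & p.2 \subset polar p.1] ->
      forall z, N e p.1 z -> forall z', N e p.2 z' -> CC z z') /\
  ((forall p : {set G} * {set G}, [&& essential p.1, essential p.2 & ~~ (p.2 \subset polar p.1)] ->
      ~ forall z, N e p.1 z -> forall z', N e p.2 z' -> CC z z') /\
  ((forall p : {set G} * {set G}, essential p.1 && (p.2 \subset center p.1) ->
      N e p.1 (e (inr p)) /\ forall z', N e p.1 z' -> CC (e (inr p)) z') /\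
  (forall p : {set G} * {set G} * {set G},
      [&& essential p.1.1, p.1.2 \subset center p.1.1, p.2 \subset center p.1.1 & p.1.2 != p.2] ->
      ~ exists g, exists r, e (inr p.1) ^ g = e (inr (p.1.1, p.2)) * (r * r))))))).

Lemma def_perp (J I' : finType) (A : {set I'}) (x : I' -> forall T : groupType, (J -> T) -> T) t :
  (forall i, term_definable (x i)) -> term_definable t ->
  @definable J (fun T e => perp A (fun i => x i T e) (t T e)).
Proof. by move=> hx ht; apply: def_fin => i _; apply: def_CC. Qed.

Lemma def_pattern : @definable (I : finType) pattern.
Proof.
have h1 (o : option I) := tdef_var o.
have h2 (o : option (option I)) := tdef_var o.
have N0 K t : term_definable t -> @definable (I : finType) (fun T e => N e K (t T e)).
  by move=> ht; apply: (@def_perp _ _ _ (fun v T e => e (inl v))) => // v; apply: tdef_var.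
have N1 K t : term_definable t ->
    @definable (option I : finType) (fun T e => N (fun i => e (Some i)) K (t T e)).
  move=> ht; apply: (@def_perp _ _ _ (fun v T e => e (Some (inl v)))) => // v; exact: tdef_var.
have N2 K t : term_definable t ->
    @definable (option (option I) : finType) (fun T e => N (fun i => e (Some (Some i))) K (t T e)).
  move=> ht; apply: (@def_perp _ _ _ (fun v T e => e (Some (Some (inl v))))) => // v; exact: tdef_var.
have sub K K' : @definable (I : finType) (fun T e => forall z, N e K z -> N e K' z).
  by apply: def_all; apply: def_imp; apply: N1.
have comm K K' : @definable (I : finType)
    (fun T e => forall z, N e K z -> forall z', N e K' z' -> CC z z').
  apply: def_all; apply: def_imp; first exact: N1.
  apply: def_all; apply: def_imp; first exact: N2.
  exact: def_CC.
apply: def_and.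
  apply: def_fin => K _; apply: def_all; apply: def_imp; first exact: N1.
  apply: def_imp; last by apply/def_not/def_bad.
  apply: def_all; apply: def_imp; first exact: N2.
  exact: def_CC.
apply: def_and; first by apply: def_fin => p _; apply: sub.
apply: def_and; first by apply: def_fin => p _; apply/def_not/sub.
apply: def_and; first by apply: def_fin => p _; apply: comm.
apply: def_and; first by apply: def_fin => p _; apply/def_not/comm.
apply: def_and; apply: def_fin => p _.
  apply: def_and; first by apply: N0; apply: tdef_var.
  by apply: def_all; apply: def_imp; [apply: N1 | apply: def_CC].
apply: def_not; apply: def_ex; apply: def_ex; apply: def_eq.
  by apply: tdef_conj; apply: h2.
by apply: tdef_mul; [apply: h2 | apply: tdef_mul; apply: h2].
Qed.

Definition standard (i : I) : raag G :=
  match i with inl v => gen v | inr p => setgen p.2 end.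

Lemma perp_gen K z : perp (polar K) (@gen G) z <-> csupp z \subset polar (polar K).
Proof.
split=> [H|/subsetP sz v vK]; last first.
  by apply/CC_gen/subsetP => u /sz/polarP/(_ _ vK); rewrite mem_starC.
apply/subsetP => u uz; apply/polarP => v /H/CC_gen/subsetP/(_ u uz).
by rewrite mem_starC.
Qed.

Lemma CC_gens K (z : raag G) : (forall u, u \in K -> CC z (gen u)) -> csupp z \subset polar K.
Proof.
move=> H; apply/subsetP => w wz; apply/polarP => u /H/CC_sym/CC_gen/subsetP/(_ w wz).
by rewrite mem_starC.
Qed.

(** For the standard tuple, [N] at [K] consists of the elements conjugate into the subgroup of [K],
    so inclusion and polarity can be tested on generators. Distinct products over subsets of a
    center have distinct parities, which conjugation and squares preserve. *)
Lemma pattern_standard : pattern standard.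
Proof.
have NE K z : essential K -> N standard K z <-> csupp z \subset K.
  by move=> /essentialP[eK _]; rewrite -{2}eK; apply: perp_gen.
have genN K u : essential K -> u \in K -> N standard K (gen u).
  by move=> eK uK; apply/NE; rewrite ?csupp_gen ?sub1set.
split=> [K eK z /NE-/(_ eK) zK zC|].
  have zP : csupp z \subset polar K by apply: CC_gens => u uK; apply/zC/genN.
  have [_ strongK] := essentialP _ eK.
  apply: (@strong_clique_not_bad _ (center K)).
  - by move=> u v /setIP[uK _] /setIP[_ vP]; apply: (polar_joined (subxx (polar K))).
  - by move=> v /setIP[]; apply: strongK.
  - by rewrite subsetI zK.
split=> [p /and3P[e1 e2 s] z /NE-/(_ e1) z1|].
  by apply/NE => //; apply: subset_trans s.
split=> [p /and3P[e1 e2 /subsetPn[u u1 u2]] H|].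
  by have /NE-/(_ e2) := H _ (genN _ _ e1 u1); rewrite csupp_gen sub1set (negPf u2).
split=> [p /and3P[e1 e2 s] z /NE-/(_ e1) z1 z' /NE-/(_ e2) z2|].
  by apply: CC_joined; apply: joinedS (polar_joined s).
split=> [p /and3P[e1 e2 /subsetPn[u u2 u1]] H|].
  case/negP: u1; apply/polarP => w w1.
  have /CC_gen := H _ (genN _ _ e1 w1) _ (genN _ _ e2 u2).
  by rewrite csupp_gen sub1set mem_starC.
split=> [[K A] /= /andP[eK /subsetIP[AK AP]]|].
  have sA : csupp (setgen A) \subset A by apply/csupp_inA/inA_setgen.
  split; first by apply/NE => //; apply: subset_trans AK.
  move=> z' /NE-/(_ eK) zK; apply: CC_joined.
  by apply: joinedS (joined_sym (polar_joined (subxx (polar K)))); rewrite ?(subset_trans sA).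
move=> [[K A] A'] /= /and4P[eK sA sA' nA] [g [r e]].
case/eqP: nA; apply/setP => u; rewrite -!parity_setgen -(parityJ u _ g) e.
by rewrite !parityM addbb addbF.
Qed.
End Pattern.

(** The first clause of the pattern makes [perpE] and [perp_essential] available; the other clauses
    then translate into statements about the sets [phi K]. *)
Lemma pattern_embedding (G D : graph) (e : (G + {set G} * {set G})%type -> raag D) :
  pattern e -> exists phi : {set G} -> {set D}, forall K, essential K ->
    [/\ essential (phi K), #|center K| <= #|center (phi K)|
      & forall K', essential K' -> (K \subset K') = (phi K \subset phi K') /\
          (K' \subset polar K) = (phi K' \subset polar (phi K))].
Proof.
case=> not_bad [sub1 [sub2 [com1 [com2 [cen1 cen2]]]]].
pose phi K := polar (\bigcup_(v in polar K) csupp (e (inl v))).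
exists phi => K eK.
have NE L z (eL : essential L) := perpE (not_bad L eL) z.
have ephi L (eL : essential L) := perp_essential (not_bad L eL).
have genN L u (eL : essential L) : u \in phi L -> perp (polar L) (fun v => e (inl v)) (gen u).
  by move=> uL; apply/(NE L); rewrite ?csupp_gen ?sub1set.
split=> [||K' eK']; first exact: ephi.
- pose z A := e (inr (K, A)); set Q := center (phi K).
  have jQ : joined Q Q.
    by move=> u v /setIP[uK _] /setIP[_ vP]; apply: (polar_joined (subxx (polar (phi K)))).
  have zQ (A : {set G}) : A \subset center K -> csupp (z A) \subset Q.
    move=> sA; have [|zN zC] := cen1 (K, A); first by rewrite eK.
    rewrite subsetI; apply/andP; split; first exact/NE.
    by apply: CC_gens => u uK; apply/zC/genN.
  (* Reading parities maps the subsets of [center K] to those of [center (phi K)]. If two images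
     agreed, the quotient of suitable conjugates would have even exponents in a clique and so be a
     square, against the last clause. *)
  pose f (A : {set G}) := [set q in Q | parity q (z A)].
  have f_inj : {in powerset (center K) &, injective f}.
    move=> A A'; rewrite !powersetE => sA sA' fAA'; apply/eqP; apply: contraT => nA; exfalso.
    apply: (cen2 (K, A, A')); first by rewrite /= eK sA sA'.
    have [a za] := csupp_conj (z A); have [b zb] := csupp_conj (z A').
    have {}za := inAS (zQ A sA) za; have {}zb := inAS (zQ A' sA') zb.
    have [||r _ er] := @clique_square D Q ((z A' ^ b)^-1 * z A ^ a) jQ.
    + by apply: inAM za; apply: inAV.
    + move=> u; rewrite parityM parityV !parityJ.
      have [uQ|uQ] := boolP (u \in Q).
        by move/setP: fAA' => /(_ u); rewrite in_set [RHS]in_set uQ /= => ->; rewrite addbb.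
      by rewrite -(parityJ u (z A) a) -(parityJ u (z A') b) !(parity_notin _ uQ).
    exists (a * b^-1), (r ^ b^-1); rewrite -[e _]/(z A) -[e _ in RHS]/(z A') /=.
    apply: (conjg_inj b); rewrite conjgM conjgKV [RHS]conjMg conjMg conjgKV -er.
    by rewrite mulVKg.
  rewrite -(leq_exp2l (m := 2)) // -!card_powerset -(card_in_imset f_inj) subset_leq_card //.
  by apply/subsetP => _ /imsetP[A _ ->]; rewrite powersetE; apply/subsetP => q; rewrite inE => /andP[].
split; apply/idP/idP => H.
- apply/subsetP => u uK; have [+ _] := NE K' (gen u) eK'.
  rewrite csupp_gen sub1set; apply.
  by apply: (sub1 (K, K')); rewrite ?eK ?eK' //; apply: genN.
- apply: contraT => nH; case: (sub2 (K, K')) => /=; first by rewrite eK eK'.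
  by move=> z /(NE K _ eK) zK; apply/NE => //; apply: subset_trans H.
- apply/subsetP => u uK'; apply/polarP => w wK.
  have /CC_gen : CC (gen w) (gen u).
    by apply: (com1 (K, K')); rewrite ?eK ?eK' //; apply: genN.
  by rewrite csupp_gen sub1set mem_starC.
apply: contraT => nH; case: (com2 (K, K')) => /=; first by rewrite eK eK'.
move=> z /(NE K _ eK) zK z' /(NE K' _ eK') zK'.
by apply: CC_joined; apply: joinedS (polar_joined H).
Qed.

Lemma elementary_equiv_embedding (G D : graph) : elementary_equiv (raag G) (raag D) ->
  exists phi : {set G} -> {set D}, forall K, essential K ->
    [/\ essential (phi K), #|center K| <= #|center (phi K)|
      & forall K', essential K' -> (K \subset K') = (phi K \subset phi K') /\
          (K' \subset polar K) = (phi K' \subset polar (phi K))].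
Proof.
move=> GD; have [|e] := elementary_equiv_ex GD (@def_pattern G).
  by exists (@standard G); apply: pattern_standard.
exact: pattern_embedding.
Qed.

(** * Uniqueness of cores *)

Section Cores.
Implicit Types G H : graph.

Definition redundant_in G (S : {set G}) v :=
  v \in S /\ exists W : {set G}, [/\ W \subset S, v \notin W & polar W :&: S = link v :&: S].

Lemma polar_bigcap G (W : {set G}) : polar W = \bigcap_(w in W) star w.
Proof.
by apply/setP => u; apply/polarP/bigcapP => H w /H; rewrite mem_starC.
Qed.

Lemma star_induced G (S : {set G}) (v w : induced S) : (w \in star v) = (val w \in star (val v)).
Proof. by rewrite !mem_star. Qed.

Lemma redundant_inP G (S : {set G}) (v : induced S) : redundant v <-> redundant_in S (val v).
Proof.
have bigcapE (W : {set induced S}) (u : induced S) :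
    (u \in \bigcap_(w in W) star w) = (val u \in polar (val @: W)).
  rewrite -polar_bigcap; apply/polarP/polarP => [H _ /imsetP[w wW ->]|H w wW].
    by rewrite -star_induced; apply: H.
  by rewrite star_induced; apply: H; rewrite imset_f.
split=> [[_ [W [W0 Wv eW]]]|[vS [W [WS vW eW]]]].
  split; first exact: valP v.
  exists (val @: W); split.
  - by apply/subsetP => _ /imsetP[w _ ->]; apply: valP.
  - by apply/negP => /imsetP[w wW /val_inj e]; have := Wv w wW; rewrite e eqxx.
  apply/setP => u; rewrite !in_setI; case: (boolP (u \in S)) => uS; rewrite ?andbF // !andbT.
  by have /= <- := bigcapE W (exist _ u uS); rewrite eW !inE.
pose W' := [set w : induced S | val w \in W].
have valW : val @: W' = W.
  apply/setP => u; apply/imsetP/idP => [[w + ->]|uW]; first by rewrite inE.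
  by exists (exist _ u (subsetP WS u uW)); rewrite ?inE.
have eW' : \bigcap_(w in W') star w = link v.
  apply/setP => u; rewrite bigcapE valW [RHS]inE.
  by move/setP: eW => /(_ (val u)); rewrite !in_setI (valP u) !andbT => ->; rewrite inE.
(* As [v] is not in its own link, some star of the family misses [v]; with this [w], the stars of
   [v] and [w] meet exactly in [link v]. *)
have [w wW vw] : exists2 w, w \in W' & v \notin star w.
  have : v \notin \bigcap_(w in W') star w by rewrite eW' notin_link.
  move=> /bigcapP nv; apply: contrapT => nex; apply: nv => w wW.
  by apply: contrapT => /negP nw; apply: nex; exists w.
split; last first.
  exists W'; split=> //; first by apply/set0Pn; exists w.
  by move=> w'; rewrite inE; apply: contraTneq => ->.
exists [set v; w]; split.
- by apply/set0Pn; exists v; rewrite set21.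
- move=> w' /set2P[] ->; first by rewrite adj_irr.
  by move: vw; rewrite mem_star negb_or adj_sym => /andP[].
rewrite -polar_bigcap polarU !polar1; apply/setP => u; rewrite in_setI mem_star.
have lw : link v \subset star w by rewrite -eW' bigcap_inf.
case: (u =P v) => [->|_] /=; first by rewrite (negPf vw) inE adj_irr.
apply/idP/idP => [/andP[vu _]|vu]; first by rewrite inE.
by rewrite (subsetP lw) // andbT; move: vu; rewrite inE.
Qed.

Inductive reach G : {set G} -> {set G} -> Prop :=
| reach_refl S : reach S S
| reach_step S v T : redundant_in S v -> reach (S :\ v) T -> reach S T.

Lemma reach_trans G (S T U : {set G}) : reach S T -> reach T U -> reach S U.
Proof. by elim=> // {}S v {}T rv _ IH /IH; apply: reach_step. Qed.

Lemma removal_reach G (S : {set G}) : removal S -> reach setT S.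
Proof.
elim=> [|{}S v _ IH /redundant_inP rv]; first exact: reach_refl.
by apply: reach_trans IH _; apply: reach_step rv _; apply: reach_refl.
Qed.

Definition core_in G (S : {set G}) := forall v, ~ redundant_in S v.

Lemma is_core_in G (S : {set G}) : is_core S -> reach setT S /\ core_in S.
Proof.
case=> /removal_reach rS cS; split=> // v rv; have [vS _] := rv.
exact/(cS (exist _ v vS))/redundant_inP.
Qed.

Lemma reach_core G (S : {set G}) : exists2 T, reach S T & core_in T.
Proof.
have [n] := ubnP #|S|; elim: n S => // n IH S ltS.
have [[v rv]|nr] := pselect (exists v, redundant_in S v); last first.
  by exists S; [exact: reach_refl | move=> v rv; apply: nr; exists v].
have [|T rT cT] := IH (S :\ v); last by exists T => //; apply: reach_step rv rT.
by rewrite -ltnS (leq_trans _ ltS) // ltnS [in X in _ <= X](cardsD1 v) (proj1 rv).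
Qed.

(** If the family of [w] contains [v] but that of [v] avoids [w], then [v] can be replaced by its
    own family. If each family contains the other vertex, the links agree elsewhere. *)
Lemma redundant_in_diamond G (S : {set G}) v w :
  redundant_in S v -> redundant_in S w -> v != w ->
  redundant_in (S :\ v) w \/
  (forall u, u \in S -> u != v -> u != w -> adj v u = adj w u).
Proof.
move=> [vS [W [WS vW eW]]] [wS [W' [WS' wW' eW']]] vw.
have wSv : w \in S :\ v by rewrite !inE eq_sym vw.
have SvE (A : {set G}) : A :&: (S :\ v) = (A :&: S) :\ v by rewrite setDE setIA -setDE.
have [vW'|vW'] := boolP (v \in W'); last first.
  left; split=> //; exists W'; split=> //; last by rewrite !SvE eW'.
  by rewrite subsetD1 WS'.
have [wW|wW] := boolP (w \in W); last first.
  left; split=> //; exists ((W' :\ v) :|: W); split.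
  - by by rewrite subUset [W \subset _]subsetD1 WS vW andbT setSD.
  - by rewrite !inE negb_or (negPf wW') andbF.
  apply/setP => u; rewrite !in_setI.
  case: (boolP (u \in S :\ v)) => [/setD1P[uv uS]|_]; last by rewrite !andbF.
  move/setP: eW => /(_ u); move/setP: eW' => /(_ u); rewrite !in_setI uS !andbT => <- hW.
  rewrite polarU in_setI hW -{2}(setD1K vW') polarU polar1 in_setI mem_star (negPf uv).
  by rewrite andbC inE.
right=> u uS uv uw.
have lv : adj v u -> u \in star w.
  move=> vu; have : u \in polar W :&: S by rewrite eW !inE vu.
  by rewrite in_setI => /andP[/polarP/(_ w wW) + _]; rewrite mem_starC.
have lw : adj w u -> u \in star v.
  move=> wu; have : u \in polar W' :&: S by rewrite eW' !inE wu.
  by rewrite in_setI => /andP[/polarP/(_ v vW') + _]; rewrite mem_starC.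
by apply/idP/idP => [/lv|/lw]; rewrite mem_star ?(negPf uv) ?(negPf uw).
Qed.

Definition piso G H (S : {set G}) (T : {set H}) (f : G -> H) :=
  [/\ {in S &, injective f}, f @: S = T
    & {in S &, forall x y, adj (f x) (f y) = adj x y}].

Lemma piso_graph_iso G H (S : {set G}) (T : {set H}) f :
  piso S T f -> graph_iso (induced S) (induced T).
Proof.
case=> f_inj fS f_adj.
have fT (x : induced S) : f (val x) \in T by rewrite -fS imset_f ?(valP x).
exists (fun x : induced S => exist _ (f (val x)) (fT x) : induced T); last first.
  by move=> x y; apply: f_adj; apply: valP.
apply: inj_card_bij.
  by move=> x y /(congr1 val) /= /f_inj e; apply/val_inj/e; apply: valP.
by rewrite !card_sig -fS card_in_imset.
Qed.

Lemma pisoD1 G H (S : {set G}) (T : {set H}) f v : piso S T f -> v \in S ->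
  piso (S :\ v) (T :\ f v) f.
Proof.
case=> f_inj fS f_adj vS; have sub x : x \in S :\ v -> x \in S by case/setD1P.
split; [by move=> x y /sub xS /sub yS; apply: f_inj | | by move=> x y /sub xS /sub yS; apply: f_adj].
apply/setP => z; rewrite -fS; apply/imsetP/setD1P => [[x /setD1P[xv xS] ->]|].
  by split; [apply: contra_neq xv; apply: f_inj | rewrite imset_f].
by move=> [zv /imsetP[x xS ez]]; exists x; rewrite // !inE xS andbT; apply: contra_neq zv => <-.
Qed.

Lemma piso_redundant G H (S : {set G}) (T : {set H}) f v : piso S T f -> v \in S ->
  redundant_in S v <-> redundant_in T (f v).
Proof.
case=> f_inj fS f_adj vS.
have fT x : x \in S -> f x \in T by move=> xS; rewrite -fS imset_f.
have f_star : {in S &, forall x y, (f x \in star (f y)) = (x \in star y)}.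
  by move=> x y xS yS; rewrite !mem_star f_adj // (inj_in_eq f_inj).
have polarE (W : {set G}) x : W \subset S -> x \in S -> (f x \in polar (f @: W)) = (x \in polar W).
  move=> /subsetP WS xS; apply/polarP/polarP => [h w wW|h _ /imsetP[w wW ->]].
    by rewrite -(f_star _ _ (WS w wW) xS); apply/h/imset_f.
  by rewrite (f_star _ _ (WS w wW) xS); apply: h.
split=> -[_ [W [WS vW eW]]].
  split; first exact: fT.
  exists (f @: W); split; first by rewrite -fS imsetS.
    by apply/imsetP => -[w wW /f_inj e]; move: vW; rewrite e ?wW // (subsetP WS).
  apply/setP => z; rewrite -fS !in_setI.
  case: (boolP (z \in f @: S)) => [/imsetP[x xS ->]|_]; last by rewrite !andbF.
  move/setP: eW => /(_ x); rewrite !in_setI xS !andbT polarE // => ->.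
  by rewrite !inE f_adj.
pose W' := [set x in S | f x \in W].
have W'S : W' \subset S by apply/subsetP => x; rewrite inE => /andP[].
have fW' : f @: W' = W.
  apply/setP => z; apply/imsetP/idP => [[x + ->]|zW]; first by rewrite inE => /andP[].
  have := subsetP WS z zW; rewrite -fS => /imsetP[x xS ez].
  by exists x; rewrite ?inE ?xS -?ez.
split=> //; exists W'; split=> //; first by rewrite inE vS.
apply/setP => x; rewrite !in_setI; case: (boolP (x \in S)) => xS; rewrite ?andbF // !andbT.
rewrite -polarE // fW' [RHS]inE -f_adj //.
by move/setP: eW => /(_ (f x)); rewrite !in_setI fT // !andbT => ->; rewrite inE.
Qed.

Lemma graph_iso_trans G1 G2 G3 : graph_iso G1 G2 -> graph_iso G2 G3 -> graph_iso G1 G3.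
Proof.
move=> [f bf fa] [g bg ga]; exists (g \o f); first exact: bij_comp.
by move=> x y; rewrite /= ga fa.
Qed.

Lemma piso_id G (S : {set G}) : piso S S id.
Proof. by split=> //; rewrite imset_id. Qed.

(* Two redundant vertices either remain redundant when the other one is removed
   or are exchanged by an automorphism. *)
Lemma core_unique G H (S S' : {set G}) (T T' : {set H}) f :
  piso S T f -> reach S S' -> core_in S' -> reach T T' -> core_in T' ->
  graph_iso (induced S') (induced T').
Proof.
have [n] := ubnP #|S|; elim: n => // n IH in G H S S' T T' f *.
move=> ltS fST rS cS' rT cT'; have [f_inj fS f_adj] := fST.
case: rS cS' fST ltS f_inj fS f_adj => [{}S|{}S v {}S' rv rS] cS' fST ltS f_inj fS f_adj.
  case: rT cT' fST fS => [{}T|{}T w {}T' rw rT] cT' fST fS; first exact: piso_graph_iso fST.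
  case: (rw); rewrite -{1}fS => /imsetP[x xS ew] _; subst w.
  by case: (cS' x); apply/(piso_redundant fST xS).
have vS : v \in S by case: rv.
have ltSv x : x \in S -> #|S :\ x| < n.
  by move=> xS; rewrite -ltnS (leq_trans _ ltS) // ltnS [in X in _ <= X](cardsD1 x) xS.
case: rT cT' fST fS => [{}T|{}T w {}T' rw rT] cT' fST fS.
  by case: (cT' (f v)); apply/(piso_redundant fST vS).
case: (rw); rewrite -{1}fS => /imsetP[v' vS' ew] _; subst w.
have rv' : redundant_in S v' by apply/(piso_redundant fST vS').
have [e|vv'] := eqVneq v v'.
  by subst v'; apply: (IH _ _ _ _ _ _ _ (ltSv v vS) (pisoD1 fST vS)).
(* When [v] and [v'] have the same other neighbors, redirecting [v'] to [f v] turns [f] into an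
   isomorphism between the two graphs left after the first removals. *)
have twin : (forall u, u \in S -> u != v -> u != v' -> adj v u = adj v' u) ->
    graph_iso (induced S') (induced T').
  move=> tw; pose g x := if x == v' then f v else f x.
  apply: (IH _ _ (S :\ v) S' (T :\ f v') T' g) => //; first exact: ltSv.
  split.
  - move=> x y /setD1P[xv xS] /setD1P[yv yS]; rewrite /g.
    case: eqP => [->|_]; case: eqP => [->|_] // /f_inj e; last exact: e.
      by move: yv; rewrite e ?eqxx.
    by move: xv; rewrite -e ?eqxx.
  - apply/setP => z; apply/imsetP/setD1P => [[x /setD1P[xv xS] ->]|].
      rewrite /g; case: (x =P v') => [_|/eqP xv']; split; rewrite -?fS ?imset_f //.
        by apply: contra_neq vv'; apply: f_inj.
      by apply: contra_neq xv'; apply: f_inj.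
    move=> [zv]; rewrite -fS => /imsetP[x xS ez]; subst z.
    have xv' : x != v' by apply: contra_neq zv => ->.
    have [xv|xv] := eqVneq x v.
      by exists v'; rewrite ?inE ?vS' 1?eq_sym ?vv' // /g eqxx xv.
    by exists x; rewrite ?inE ?xv // /g (negPf xv').
  move=> x y /setD1P[xv xS] /setD1P[yv yS]; rewrite /g.
  case: eqP => [->|/eqP xv']; case: eqP => [->|/eqP yv']; rewrite ?adj_irr ?f_adj //.
    exact: tw.
  by rewrite adj_sym [RHS]adj_sym; apply: tw.
have [r1|] := redundant_in_diamond rv rv' vv'; last exact: twin.
have [r2|tw] := redundant_in_diamond rv' rv (contra_neq (@esym _ _ _) vv'); last first.
  by apply: twin => u uS uv uv'; rewrite tw.
(* Both removals commute, so a core below the common remainder can be compared with each of the two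
   given ones. *)
have [U rU cU] := reach_core (S :\ v :\ v').
have eD : S :\ v :\ v' = S :\ v' :\ v by rewrite !setDDl setUC.
apply: (@graph_iso_trans _ (induced U)).
  apply: (IH _ _ _ _ _ _ id (ltSv v vS) (piso_id _) rS cS' _ cU).
  exact: reach_step r1 rU.
apply: (IH _ _ _ _ _ _ f (ltSv v' vS') (pisoD1 fST vS') _ cU rT cT').
by apply: reach_step r2 _; rewrite -eD.
Qed.
End Cores.

(** * The lattice of essential sets *)

Section Essential.
Variable G : graph.
Implicit Types (K S W : {set G}) (u v w : G).

Lemma weakvP v : reflect (exists2 w, w \notin star v & link v \subset star w) (weakv v).
Proof. by apply: (iffP existsP) => [[w /andP[]]|[w nw lw]]; exists w; rewrite ?nw. Qed.

(** This is the largest essential set whose polar contains [v], as [sub_rstar] and [rstar_essential]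
    show. *)
Definition rstar v := if weakv v then link v else star v.

Lemma rstar_star v : rstar v \subset star v.
Proof. by rewrite /rstar; case: ifP => // _; apply: link_star. Qed.

Lemma link_rstar v : link v \subset rstar v.
Proof. by rewrite /rstar; case: ifP => // _; apply: link_star. Qed.

Lemma essential_polar K : essential K -> essential (polar K).
Proof.
move=> /essentialP[eK sK]; apply/essentialP; split; first exact: polar3.
by move=> v vP; rewrite eK => vK; apply: sK.
Qed.

(** Suppose a center vertex [v] of the intersection is weak by [w]. In each of the two sets [v] is
    not central, so its polar lies in [link v], hence in [star w]; thus [w] belongs to both sets and
    so to [star v]. *)
Lemma essentialI K K' : essential K -> essential K' -> essential (K :&: K').
Proof.
move=> eK eK'; apply/essentialP; split=> [|v vKK vP].
  have [cK _] := essentialP _ eK; have [cK' _] := essentialP _ eK'.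
  have -> : K :&: K' = polar (polar K :|: polar K') by rewrite polarU cK cK'.
  exact: polar3.
apply/negP => /weakvP[w nw lw].
have wL L : essential L -> v \in L -> w \in L.
  move=> /essentialP[cL sL] vL; rewrite -cL; apply/polarP => k kL.
  have [e|kv] := eqVneq k v.
    have := sL v vL; rewrite -e kL => /(_ isT)/negP[]; rewrite e; apply/weakvP.
    by exists w.
  apply: (subsetP lw).
  by have /polarP/(_ v vL) := kL; rewrite mem_star eq_sym (negPf kv) /= inE adj_sym.
have /setIP[vK vK'] := vKK.
case/negP: nw; have /polarP/(_ w) := vP; by apply; rewrite inE (wL K) // (wL K').
Qed.

Lemma essentialT : essential [set: G].
Proof.
apply/essentialP; split; first by apply/eqP; rewrite -subTset sub_bipolar.
by move=> v _ /polarP vT; apply/negP => /weakvP[w /negP[]]; apply: vT.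
Qed.

Lemma rstar_essential v : essential (rstar v).
Proof.
(* A central [u] in [link v] cannot be weak: a witness [w] would be adjacent or equal to [v], hence
   in [K] or equal to [v], and so in [star u]. *)
have strong_center u w K : u \in K -> u \in polar K -> link v \subset K -> K \subset star v ->
    u \in link v -> w \notin star u -> link u \subset star w -> False.
  move=> uK uP lvK Ks uv nw lw; have vu : v \in link u by rewrite inE adj_sym; move: uv; rewrite inE.
  have wv : w \in star v by rewrite mem_starC (subsetP lw).
  have [e|nwv] := eqVneq w v.
    by move: nw; rewrite e (subsetP (link_star u)).
  have wK : w \in K by apply: (subsetP lvK); move: wv; rewrite mem_star (negPf nwv) inE.
  by case/negP: nw; rewrite mem_starC; have /polarP/(_ w wK) := uP; rewrite mem_starC.
rewrite /rstar; case: ifPn => [/weakvP[w nw lw]|sv]; apply/essentialP; split.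
- apply/eqP; rewrite eqEsubset sub_bipolar andbT; apply/subsetP => u /polarP uP.
  have uv : u \in star v by rewrite mem_starC; apply: uP; rewrite inE link_star.
  have uw : u \in star w by rewrite mem_starC; apply: uP; rewrite inE.
  move: uv; rewrite mem_star inE; case: eqP => //= e.
  by move: uw nw; rewrite e mem_starC => ->.
- move=> u ul uP; apply/negP => /weakvP[w' nw' lw'].
  exact: (strong_center u w' _ ul uP (subxx _) (link_star v) ul nw' lw').
- by rewrite -polar1 polar3.
move=> u us uP; have [->//|uv] := eqVneq u v; apply/negP => /weakvP[w' nw' lw'].
apply: (strong_center u w' _ us uP (link_star v) (subxx _) _ nw' lw').
by move: us; rewrite mem_star (negPf uv) inE.
Qed.

Lemma sub_rstar K u : essential K -> u \in polar K -> K \subset rstar u.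
Proof.
move=> /essentialP[_ sK] uP; rewrite /rstar; have := uP; rewrite inE => Ks.
case: ifPn => // wu; apply/subsetP => k kK.
have := subsetP Ks k kK; rewrite mem_star inE; case: eqP => //= e.
by have := sK u; rewrite -{1}e kK uP wu => /(_ isT isT).
Qed.

Lemma mem_polar_rstar u : u \in polar (rstar u).
Proof. by rewrite inE rstar_star. Qed.

Lemma mem_rstar u : (u \in rstar u) = ~~ weakv u.
Proof. by rewrite /rstar; case: ifP => _; rewrite ?star_refl ?(negPf (notin_link _)). Qed.

Lemma polar_rstar_sub u : (polar (rstar u) \subset rstar u) = ~~ weakv u.
Proof.
apply/idP/idP => [s|sv]; first by rewrite -mem_rstar (subsetP s) ?mem_polar_rstar.
by rewrite /rstar (negPf sv) sub_polar_star ?star_refl.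
Qed.

Definition nstrong K := #|[set v | ~~ weakv v & star v == K]|.

(** Center vertices are not weak and are sorted by their stars; a vertex with star [K'] is central
    in [K] exactly when [K] lies between [polar K'] and [K']. *)
Lemma card_center K : essential K -> #|center K| =
  \sum_(K' | [&& essential K', K \subset K' & polar K' \subset K]) nstrong K'.
Proof.
move=> eK; rewrite -sum1_card (partition_big (@star G)
    (fun K' => [&& essential K', K \subset K' & polar K' \subset K])) /=.
  apply: eq_bigr => K' /and3P[eK' s1 s2]; rewrite sum1_card; apply: eq_card => v.
  rewrite [RHS]in_set unfold_in /= in_setI.
  apply/andP/andP => [[/andP[vK vP] /eqP ev]|[sv /eqP ev]]; split; rewrite ?ev //.
    by have [_ sK] := essentialP _ eK; apply: sK.
  by rewrite -ev in s1 s2; rewrite inE s1 (subsetP s2) // inE.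
move=> v /setIP[vK vP]; have [cK sK] := essentialP _ eK.
have := rstar_essential v; rewrite /rstar (negPf (sK v vK vP)) => -> /=.
move: vP; rewrite inE => -> /=; rewrite -cK polarS //.
by rewrite -polar1 polar_subC cK sub1set.
Qed.

(** Meet-irreducibility among essential sets: there is a least essential set strictly above [K]. *)
Definition irr K := [exists K1, [&& essential K1, K \proper K1 &
  [forall K', essential K' && (K \proper K') ==> (K1 \subset K')]]].

(* The number of weak vertices with link [K] to be kept: none when [K] is an
   intersection of larger essential sets or the star of a vertex that is not
   weak; two when the vertices of [polar K] outside the center all have link
   [K], since they then generate a free group, whose graph has a core with two
   vertices; one otherwise. *)
Definition mult K : nat :=
  if irr K && ~~ (polar K \subset K) then
    if [exists K', [&& essential K', K \proper K' & ~~ (polar K' \subset K)]] then 1%N else 2%N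
  else 0%N.

Lemma irrP K : reflect (exists K1, [/\ essential K1, K \proper K1 &
  forall K', essential K' -> K \proper K' -> K1 \subset K']) (irr K).
Proof.
apply: (iffP existsP) => -[K1]; first case/and3P => e1 p1 /forallP H; last case=> e1 p1 H;
  exists K1.
  by split=> // K' e' p'; have := H K'; rewrite e' p'.
by rewrite e1 p1; apply/forall_inP => K' /andP[]; apply: H.
Qed.

(** Otherwise each [rstar u] with [u] in [polar K] would contain the upper cover [K1], forcing [K1]
    into the bipolar of [K]. *)
Lemma irr_rstar K : essential K -> irr K -> exists2 u, u \in polar K & rstar u = K.
Proof.
move=> eK /irrP[K1 [e1 p1 H]]; apply: contrapT => nex.
have [cK _] := essentialP _ eK.
have : K1 \subset polar (polar K).
  rewrite polar_subC; apply/subsetP => u uP; rewrite inE.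
  apply: subset_trans (rstar_star u); apply: H (rstar_essential u) _.
  rewrite properEneq sub_rstar // andbT; apply/eqP => e; apply: nex.
  by exists u.
by rewrite cK; case/andP: p1 => _ /negP.
Qed.

Lemma not_irr K x : essential K -> ~~ irr K -> x \notin K ->
  exists K', [/\ essential K', K \proper K' & x \notin K'].
Proof.
move=> eK nK xK; apply: contrapT => nex; case/negP: nK; apply/irrP.
pose K1 := \bigcap_(K' | essential K' && (K \proper K')) K'.
have xK1 : x \in K1.
  apply/bigcapP => K' /andP[e' p']; apply: contrapT => /negP xK'; apply: nex.
  by exists K'.
exists K1; split.
- rewrite /K1; elim/big_ind: _ => [|L L'|L /andP[]//]; [exact: essentialT | exact: essentialI].
- apply/properP; split; last by exists x.
  by apply/bigcapsP => K' /andP[_ /proper_sub].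
by move=> K' e' p'; apply: bigcap_inf; rewrite e' p'.
Qed.

Definition weak_class K := [set v | weakv v & link v == K].

(** Weak vertices with a common link are interchangeable, so the first ones in the enumeration are
    kept. *)
Definition survivor := [set v | weakv v ==>
  (index v (enum (weak_class (link v))) < mult (link v))].

Lemma rstar_weak u K : rstar u = K -> ~~ (polar K \subset K) -> u \in weak_class K.
Proof.
by move=> <-; rewrite polar_rstar_sub negbK inE => wu; rewrite /rstar wu eqxx.
Qed.

Lemma mult_le K : essential K -> mult K <= #|weak_class K|.
Proof.
move=> eK; rewrite /mult; case: ifP => // /andP[iK nK].
have [u uP eu] := irr_rstar eK iK; have uC := rstar_weak eu nK.
case: ifPn => [_|/existsPn nex]; first by apply/card_gt0P; exists u.
move: (uC); rewrite inE => /andP[/weakvP[w nw lw] /eqP lu].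
have wP : w \in polar K by rewrite inE -lu.
(* The second vertex is the witness [w] itself: a strictly larger [rstar w] would have its polar,
   which contains [w], inside [link u]. *)
have ew : rstar w = K.
  apply/eqP; apply: contraT => ne; have := nex (rstar w).
  rewrite rstar_essential properEneq eq_sym ne sub_rstar //= negbK => /subsetP/(_ w (mem_polar_rstar w)).
  by rewrite -lu inE => wu; move: nw; rewrite mem_star wu orbT.
have wC := rstar_weak ew nK.
have wD : w \in weak_class K :\ u.
  by rewrite in_setD1 wC andbT; apply: contraNneq nw => ->; rewrite star_refl.
by rewrite (cardsD1 u) uC (cardsD1 w) wD.
Qed.

Lemma card_survivor_weak K : essential K ->
  #|[set v in survivor | v \in weak_class K]| = mult K.
Proof.
move=> eK; have le := mult_le eK; set s := enum (weak_class K).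
have ss : size s = #|weak_class K| by rewrite -cardE.
rewrite -[RHS](size_takel (s := s)) ?ss // -(card_uniqP (take_uniq _ (enum_uniq _))).
apply: eq_card => v; rewrite in_set.
have [vC|vC] := boolP (v \in weak_class K).
  rewrite in_take ?mem_enum // andbT in_set.
  by move: (vC); rewrite in_set => /andP[-> /eqP ->].
by rewrite andbF; apply/esym/negbTE; apply: contra vC => /mem_take; rewrite mem_enum.
Qed.

(** By induction from larger sets, each [x] outside [K] is separated from [K] by the star of a
    survivor. The difficulty is an [x] that is itself a weak vertex with link [K], which its own
    star cannot exclude; the values of [mult] are made for this case. *)
Lemma polar_survivor K : essential K -> polar (survivor :&: polar K) = K.
Proof.
have [n] := ubnP #|~: K|; elim: n K => // n IH K ltK eK.
have [cK sK] := essentialP _ eK.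
apply/eqP; rewrite eqEsubset; apply/andP; split; last by rewrite polar_subC subsetIr.
apply/subsetP => x; apply: contraLR => xK.
suff [w wS [wP nw]] : exists2 w, w \in survivor & w \in polar K /\ x \notin star w.
  apply/negP => /polarP/(_ w); rewrite in_setI wS wP mem_starC => /(_ isT).
  exact/negP.
have larger K' : essential K' -> K \proper K' -> x \notin K' ->
    exists2 w, w \in survivor & w \in polar K /\ x \notin star w.
  move=> e' p' xK'; have lt' : #|~: K'| < n.
    by rewrite -ltnS (leq_trans _ ltK) // ltnS proper_card // properC.
  rewrite -(IH K' lt' e') inE in xK'; have [w] := subsetPn xK'.
  rewrite in_setI => /andP[wS wP] nw; exists w => //; split; last by rewrite mem_starC.
  by apply: subsetP wP; apply/polarS/proper_sub.
have [iK|nK] := boolP (irr K); last first.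
  by have [K' [e' p' xK']] := not_irr eK nK xK; apply: larger xK'.
have [u uP eu] := irr_rstar eK iK.
have [pK|pK] := boolP (polar K \subset K).
  have su : ~~ weakv u by rewrite -polar_rstar_sub eu.
  exists u; first by rewrite inE (negPf su).
  by split=> //; move: eu; rewrite /rstar (negPf su) => ->.
have := card_survivor_weak eK; rewrite /mult iK pK /=.
have memC w : w \in [set v in survivor | v \in weak_class K] ->
    [/\ w \in survivor, weakv w & link w = K].
  by rewrite inE => /andP[wS]; rewrite inE => /andP[ww /eqP].
have lP w : link w = K -> w \in polar K by move=> <-; rewrite inE link_star.
have lx w : link w = K -> x != w -> x \notin star w.
  by move=> lw xw; rewrite mem_star (negPf xw) -[adj w x]/(_ : bool) /=; move: xK; rewrite -lw inE.
case: ifP => [/existsP[K' /and3P[e' p' nK']]|_] cardC.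
  have /card_gt0P[w /memC[wS ww lw]] : 0 < #|[set v in survivor | v \in weak_class K]|.
    by rewrite cardC.
  have [e|xw] := eqVneq x w; last by exists w => //; split; [apply: lP | apply: lx].
  (* With one copy kept, the larger set [K'] excludes [w]: a vertex of [polar K'] outside [K] is not
     adjacent to [w], and [w] is not central in [K'] because it is weak. *)
  apply: (larger K') => //; rewrite e; apply/negP => wK'.
  have [k kP nk] := subsetPn nK'.
  have := polarP _ _ kP w wK'; rewrite mem_star => /orP[/eqP ew|].
    rewrite -ew in kP; have [_ /(_ w wK' kP)] := essentialP _ e'.
    by rewrite ww.
  by rewrite adj_sym => wk; move: nk; rewrite -lw inE wk.
have [w1 [w2 [/memC[s1 k1 l1] /memC[s2 k2 l2] n12]]] : exists w1 w2,
    [/\ w1 \in [set v in survivor | v \in weak_class K],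
        w2 \in [set v in survivor | v \in weak_class K] & w1 != w2].
  have /card_gt1P[w1 [w2 [h1 h2 h]]] : (1 < #|[set v in survivor | v \in weak_class K]|)%N.
    by rewrite cardC.
  by exists w1, w2.
have [e|xw] := eqVneq x w1; last by exists w1 => //; split; [apply: lP | apply: lx].
by exists w2 => //; split; [apply: lP | apply: lx => //; rewrite e].
Qed.

Lemma redundant_in_survivor S v : survivor \subset S -> v \in S -> v \notin survivor ->
  redundant_in S v.
Proof.
move=> sS vS; rewrite inE negb_imply => /andP[wv nv].
split=> //; exists (survivor :&: polar (link v)).
have el : essential (link v) by have := rstar_essential v; rewrite /rstar wv.
split; first by rewrite (subset_trans (subsetIl _ _)).
  by rewrite !inE wv /= (negPf nv).
by rewrite polar_survivor.
Qed.

Lemma reach_survivor : reach setT survivor.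
Proof.
suff H S : survivor \subset S -> reach S survivor by apply: H; apply: subsetT.
have [n] := ubnP #|S|; elim: n S => // n IH S ltS sS.
have [/eqP e|[v]] := set_0Vmem (S :\: survivor).
  rewrite (_ : S = survivor); first exact: reach_refl.
  by apply/eqP; rewrite eqEsubset sS andbT -setD_eq0.
move=> /setDP[vS vn]; apply: reach_step (redundant_in_survivor sS vS vn) _.
apply: IH; last by rewrite subsetD1 sS.
by rewrite -ltnS (leq_trans _ ltS) // ltnS [in X in _ <= X](cardsD1 v) vS.
Qed.

Lemma card_survivor K : essential K ->
  #|[set v in survivor | rstar v == K]| = nstrong K + mult K.
Proof.
move=> eK; rewrite -(card_survivor_weak eK) -(cardsID [set v | weakv v]) addnC.
congr addn; apply: eq_card => v; rewrite !inE /rstar; case: (weakv v) => //=;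
  by rewrite ?andbF ?andbT.
Qed.

(** Adjacency is thus read off the essential sets. For the direct implication, a vertex [j] of
    [polar (rstar v)] is in [star u], and if [j] is [u] then [u] is central in [rstar v] and not
    weak; so [j] lies in [rstar u]. *)
Lemma adj_rstar u v : u != v -> adj u v = (polar (rstar u) \subset rstar v).
Proof.
move=> uv; have [cv sv] := essentialP _ (rstar_essential v).
apply/idP/idP => [a|/subsetP/(_ u (mem_polar_rstar u))/(subsetP (rstar_star v))]; last first.
  by rewrite mem_star (negPf uv) adj_sym.
have uK : u \in rstar v by apply: (subsetP (link_rstar v)); rewrite inE adj_sym.
apply/subsetP => k /polarP kP; rewrite -cv; apply/polarP => j jP.
have [e|ju] := eqVneq j u.
  by subst j; apply: kP; rewrite mem_rstar; apply: sv uK jP.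
apply: kP; apply: (subsetP (link_rstar u)).
by have /polarP/(_ u uK) := jP; rewrite mem_star eq_sym (negPf ju) /= inE adj_sym.
Qed.
End Essential.

(** * Recovering the core *)

(** A last remaining vertex is not redundant: its family would be empty, and the empty intersection
    contains the vertex. *)
Lemma reach_neq0 (G : graph) (S T : {set G}) : reach S T -> S != set0 -> T != set0.
Proof.
elim=> // {}S v {}T [vS [W [WS vW eW]]] _ IH _; apply: IH; apply/negP => /eqP S0.
have W0 : W = set0.
  apply/eqP; rewrite -subset0 -S0; apply/subsetP => w wW.
  by rewrite !inE (subsetP WS) // andbT; apply: contraNneq vW => <-.
move/setP: eW => /(_ v); rewrite !in_setI vS !andbT (negPf (notin_link v)).
by rewrite W0 inE sub0set.
Qed.

Section Fibers.
Variable X : eqType.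

Lemma fiber_injection (A B : finType) (r : A -> X) (r' : B -> X) :
  (forall x, #|[set a | r a == x]| = #|[set b | r' b == x]|) ->
  exists2 f : A -> B, injective f & forall a, r' (f a) = r a.
Proof.
move=> card_eq; pose F x := enum [set a | r a == x]; pose F' x := enum [set b | r' b == x].
have sizeF x : size (F x) = size (F' x) by rewrite -!cardE.
have memF a : a \in F (r a) by rewrite mem_enum inE.
have idx a : index a (F (r a)) < size (F' (r a)) by rewrite -sizeF index_mem.
have inhB (a : A) : exists b : B, True.
  by case: (F' (r a)) (idx a) => // b s _; exists b.
have [d _] := choice inhB.
(* Elements are matched by their positions in the enumerations of corresponding fibers. *)
pose f a := nth (d a) (F' (r a)) (index a (F (r a))).
have rf a : r' (f a) = r a.
  by have := mem_nth (d a) (idx a); rewrite mem_enum inE => /eqP.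
exists f => // a b e; have er : r a = r b by rewrite -rf e rf.
move/eqP: e; rewrite /f -er (set_nth_default (d a) (d b)); last by rewrite -sizeF er sizeF.
rewrite nth_uniq ?enum_uniq //; last by rewrite er.
by move=> /eqP e; rewrite -(nth_index a (memF a)) e er nth_index.
Qed.

Lemma fiber_bijection (A B : finType) (r : A -> X) (r' : B -> X) :
  (forall x, #|[set a | r a == x]| = #|[set b | r' b == x]|) ->
  exists2 f : A -> B, bijective f & forall a, r' (f a) = r a.
Proof.
move=> card_eq; have [f f_inj rf] := fiber_injection card_eq.
have [g g_inj _] := fiber_injection (fun x => esym (card_eq x)).
by exists f => //; apply: inj_card_bij f_inj (leq_card g g_inj).
Qed.
End Fibers.

Section Transfer.
Variables (G D : graph) (phi : {set G} -> {set D}) (psi : {set D} -> {set G}).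

Definition essential_embedding (G1 G2 : graph) (f : {set G1} -> {set G2}) :=
  forall K, essential K -> [/\ essential (f K), #|center K| <= #|center (f K)|
    & forall K', essential K' -> (K \subset K') = (f K \subset f K') /\
          (K' \subset polar K) = (f K' \subset polar (f K))].

Lemma embedding_inj (G1 G2 : graph) (f : {set G1} -> {set G2}) :
  essential_embedding f -> {in [set K | essential K] &, injective f}.
Proof.
move=> fE K K'; rewrite !inE => eK eK' e; have [_ _ /(_ _ eK')[s1 _]] := fE K eK.
have [_ _ /(_ _ eK)[s2 _]] := fE K' eK'.
by apply/eqP; rewrite eqEsubset s1 s2 e subxx.
Qed.

Lemma embedding_card (G1 G2 : graph) (f : {set G1} -> {set G2}) :
  essential_embedding f ->
  #|[set K : {set G1} | essential K]| <= #|[set K : {set G2} | essential K]|.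
Proof.
move=> fE; rewrite -(card_in_imset (embedding_inj fE)) subset_leq_card //.
by apply/subsetP => _ /imsetP[K + ->]; rewrite !inE => /fE[].
Qed.

Lemma embedding_center (G1 G2 : graph) (f : {set G1} -> {set G2}) :
  essential_embedding f ->
  \sum_(K in [set K : {set G1} | essential K]) #|center (f K)| <=
  \sum_(K in [set K : {set G2} | essential K]) #|center K|.
Proof.
move=> fE; rewrite -(big_imset (fun L => #|center L|) (embedding_inj fE)) /=.
rewrite big_mkcond [X in _ <= X]big_mkcond /=; apply: leq_sum => L _.
case: imsetP => // -[K]; rewrite inE => /fE[eK _ _] ->.
by rewrite inE eK.
Qed.

Hypotheses (phiE : essential_embedding phi) (psiE : essential_embedding psi).

Let phi_ess K : essential K -> essential (phi K).
Proof. by case/phiE. Qed.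

Let phi_sub K K' : essential K -> essential K' -> (phi K \subset phi K') = (K \subset K').
Proof. by move=> /phiE[_ _ h] /h[->]. Qed.

(** Embeddings in both directions give equally many essential sets, so [phi] is onto. *)
Let phi_imset : phi @: [set K | essential K] = [set K | essential K].
Proof.
apply/eqP; rewrite eqEcard (card_in_imset (embedding_inj phiE)) (embedding_card psiE) andbT.
by apply/subsetP => _ /imsetP[K + ->]; rewrite !inE => /phi_ess.
Qed.

Let phi_surj L : essential L -> exists2 K, essential K & phi K = L.
Proof.
move=> eL; have : L \in phi @: [set K | essential K] by rewrite phi_imset inE.
by case/imsetP=> K; rewrite inE => eK ->; exists K.
Qed.

Let sum_phi (F : {set D} -> nat) (P : pred {set D}) :
  \sum_(L | essential L && P L) F L = \sum_(K | essential K && P (phi K)) F (phi K).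
Proof.
rewrite (eq_bigl (fun L => (L \in phi @: [set K | essential K]) && P L)); last first.
  by move=> L; rewrite phi_imset inE.
rewrite big_mkcondr big_imset /=; last exact: embedding_inj.
by rewrite [RHS]big_mkcondr /=; apply: eq_bigl => K; rewrite inE.
Qed.

(** Centers do not shrink along [phi], and [psi] bounds their total size; hence every inequality is
    an equality. *)
Let phi_center K : essential K -> #|center (phi K)| = #|center K|.
Proof.
move=> eK; pose c (G1 : graph) := \sum_(L in [set L : {set G1} | essential L]) #|center L|.
have le (G1 G2 : graph) (f : {set G1} -> {set G2}) : essential_embedding f -> c G1 <= c G2.
  move=> fE; apply: leq_trans (embedding_center fE).
  by apply: leq_sum => L; rewrite inE => /fE[].
have cK L : L \in [set L : {set G} | essential L] ->
    #|center L| <= #|center (phi L)| ?= iff (#|center L| == #|center (phi L)|).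
  by rewrite inE => /phiE[_ h _]; apply: leqif_eq.
have [le_sum] := leqif_sum cK.
rewrite eqn_leq le_sum (leq_trans (embedding_center phiE)) ?(le _ _ psi) // => /esym/forall_inP/(_ K).
by rewrite inE => /(_ eK)/eqP.
Qed.

Let phi_polar_sub K K' : essential K -> essential K' ->
  (phi K' \subset polar (phi K)) = (K' \subset polar K).
Proof. by move=> /phiE[_ _ h] /h[_ ->]. Qed.

Let phi_polar K : essential K -> phi (polar K) = polar (phi K).
Proof.
move=> eK; have eP := essential_polar eK; have eL := essential_polar (phi_ess eK).
apply/eqP; rewrite eqEsubset phi_polar_sub // subxx /=.
have [K' eK' e] := phi_surj eL.
by rewrite -e phi_sub // -phi_polar_sub // e.
Qed.

Let phi_polar_sub_l K K' : essential K -> essential K' ->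
  (polar (phi K) \subset phi K') = (polar K \subset K').
Proof. by move=> eK eK'; rewrite -phi_polar // phi_sub // essential_polar. Qed.

Let phi_proper K K' : essential K -> essential K' -> (phi K \proper phi K') = (K \proper K').
Proof. by move=> eK eK'; rewrite !properE !phi_sub. Qed.

Let nstrong0 (G1 : graph) (K : {set G1}) : ~~ (polar K \subset K) -> nstrong K = 0.
Proof.
move=> nK; apply: eq_card0 => v; rewrite in_set; apply/negbTE; apply: contra nK.
by move=> /andP[_ /eqP <-]; apply: sub_polar_star (star_refl v).
Qed.

(** When [polar K] lies in [K], the formula [card_center] is [nstrong K] plus terms for strictly
    larger sets, so it can be inverted from the top down. *)
Let phi_nstrong K : essential K -> nstrong (phi K) = nstrong K.
Proof.
have [n] := ubnP #|~: K|; elim: n K => // n IH K ltK eK.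
have eL := phi_ess eK.
have [sK|nK] := boolP (polar K \subset K); last by rewrite !nstrong0 // phi_polar_sub_l.
have := phi_center eK; rewrite !card_center //.
rewrite (sum_phi _ (fun L => (phi K \subset L) && (polar L \subset phi K))).
rewrite (bigD1 K) ?eK ?subxx ?phi_polar_sub_l // [RHS](bigD1 K) ?eK ?subxx ?sK //=.
rewrite (eq_bigl (fun L => [&& essential L, K \subset L & polar L \subset K] && (L != K))); last first.
  move=> L; case: (boolP (essential L)) => //= e; by rewrite phi_sub // phi_polar_sub_l.
rewrite (eq_bigr (@nstrong G)) => [/eqP|L /andP[/and3P[e s _] ne]].
  by rewrite eqn_add2r => /eqP.
apply: IH => //; rewrite -ltnS (leq_trans _ ltK) // ltnS proper_card // properC.
by rewrite properEneq eq_sym ne.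
Qed.

Let phi_irr K : essential K -> irr (phi K) = irr K.
Proof.
move=> eK; apply/irrP/irrP => -[K1 [e1 p1 h1]].
  have [K2 e2 eK2] := phi_surj e1; subst K1; exists K2; split=> //; first by rewrite -phi_proper.
  by move=> K' e' p'; rewrite -phi_sub //; apply: h1; rewrite ?phi_ess ?phi_proper.
exists (phi K1); split; rewrite ?phi_ess ?phi_proper //.
by move=> L /phi_surj[K' e' <-]; rewrite phi_proper // phi_sub //; apply: h1.
Qed.

Let phi_mult K : essential K -> mult (phi K) = mult K.
Proof.
move=> eK; rewrite /mult phi_irr // phi_polar_sub_l //.
have -> // : [exists L, [&& essential L, phi K \proper L & ~~ (polar L \subset phi K)]] =
    [exists K', [&& essential K', K \proper K' & ~~ (polar K' \subset K)]].
apply/existsP/existsP => -[K' /and3P[e' p' n']].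
  have [K2 e2 eK2] := phi_surj e'; subst K'; exists K2.
  by rewrite e2 -phi_proper // p' -phi_polar_sub_l.
by exists (phi K'); rewrite phi_ess // phi_proper // p' phi_polar_sub_l.
Qed.

Let card_induced (G1 : graph) (S : {set G1}) (P : pred G1) :
  #|[set x : induced S | P (val x)]| = #|[set v in S | P v]|.
Proof.
rewrite -(card_imset _ val_inj); apply: eq_card => v; rewrite [RHS]in_set.
apply/imsetP/andP => [[x + ->]|[vS Pv]]; first by rewrite inE; split=> //; apply: valP.
by exists (exist _ v vS); rewrite ?inE.
Qed.

(** By [card_survivor] the fibers of [rstar] have sizes determined by the matched data; a bijection
    respecting them preserves adjacency by [adj_rstar]. *)
Lemma survivor_iso : graph_iso (induced (survivor G)) (induced (survivor D)).
Proof.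
have [|f f_bij rf] := @fiber_bijection _ (induced (survivor G)) (induced (survivor D))
    (fun x => phi (rstar (val x))) (fun x => rstar (val x)).
  move=> L; rewrite (card_induced _ (fun v => phi (rstar v) == L)).
  rewrite (card_induced _ (fun v => rstar v == L)).
  have [eL|nL] := boolP (essential L); last first.
    rewrite !eq_card0 // => v; rewrite in_set; apply/negbTE; apply: contra nL => /andP[_ /eqP <-].
      exact: rstar_essential.
    exact/phi_ess/rstar_essential.
  have [K eK e] := phi_surj eL; rewrite card_survivor // -e phi_nstrong // phi_mult // -card_survivor //.
  apply: eq_card => v; rewrite !in_set; congr (_ && _).
  apply/eqP/eqP => [|->//]; apply: (embedding_inj phiE); rewrite inE //.
  exact: rstar_essential.
exists f => // x y; have [->|xy] := eqVneq x y; first by rewrite !adj_irr.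
rewrite /= /induced_adj !adj_rstar ?(inj_eq val_inj) //.
  by rewrite !rf phi_polar_sub_l //; apply: rstar_essential.
by rewrite (inj_eq (bij_inj f_bij)).
Qed.
End Transfer.

Lemma iso_piso (G D : graph) (S : {set G}) (T : {set D}) (d : G -> D) :
  graph_iso (induced S) (induced T) -> exists f, piso S T f.
Proof.
case=> h h_bij h_adj; exists (fun v => if insub v is Some x then val (h x) else d v).
have hE v (vS : v \in S) : (if insub v is Some x then val (h x) else d v) = val (h (exist _ v vS)).
  by rewrite (insubT (fun v => v \in S) vS).
split.
- move=> x y xS yS; rewrite !hE => /val_inj/(bij_inj h_bij).
  by move/(congr1 val).
- apply/setP => z; apply/imsetP/idP => [[x xS ->]|zT]; first by rewrite hE; apply: valP.
  have [g hK gK] := h_bij; set y := g (exist _ z zT : induced T).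
  exists (val y); first exact: valP.
  by rewrite (hE _ (valP y)) (_ : exist _ _ _ = y) ?gK //; apply: val_inj.
move=> x y xS yS; rewrite !hE; exact: (h_adj (exist _ x xS) (exist _ y yS)).
Qed.

Theorem corollary10p6 (Gamma Delta : graph) :
  elementary_equiv (raag Gamma) (raag Delta) ->
  forall (S : {set Gamma}) (T : {set Delta}),
    is_core S -> is_core T -> graph_iso (induced S) (induced T).
Proof.
move=> GD S T /is_core_in[rS cS] /is_core_in[rT cT].
have [phi phiE] := elementary_equiv_embedding GD.
have [|psi psiE] := @elementary_equiv_embedding Delta Gamma; first by move=> f; split=> /GD.
have iso := survivor_iso phiE psiE.
(* A map on all of [Gamma] needs default values in [Delta]: if [Gamma] has a vertex, it has a
   survivor, whose image is a vertex of [Delta]. *)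
have inhD (v : Gamma) : exists w : Delta, True.
  have [h _ _] := iso; have : survivor Gamma != set0.
    by apply: reach_neq0 (reach_survivor Gamma) _; apply/set0Pn; exists v.
  by case/set0Pn=> w wS; exists (val (h (exist _ w wS))).
have [d _] := choice inhD.
have [f fP] := iso_piso d iso.
(* A core of the survivor graph is a core of the whole graph, so uniqueness links [S] to [U], [U] to
   [V], and [V] to [T]. *)
have [U rU cU] := reach_core (survivor Gamma).
have [V rV cV] := reach_core (survivor Delta).
have SU := core_unique (piso_id _) rS cS (reach_trans (reach_survivor _) rU) cU.
have UV := core_unique fP rU cU rV cV.
have VT := core_unique (piso_id _) (reach_trans (reach_survivor _) rV) cV rT cT.
exact: graph_iso_trans SU (graph_iso_trans UV VT).
Qed.
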